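(* Let $G=(V,E,\nu,\mu)$ be a weighted graph such that $M:=\sup_{x\in V}\frac{\deg_x}{\nu_x}<\infty$, and let $p\in(1,2]$. Then there exists a constant $C>0$ such that $$\|\mathcal{H}f\|_{\ell^p(E,\mu)}\le C\|f\|_{\ell^p(V,\nu)}\quad\text{for all } f\in\mathcal{C}_0(V).$$ Moreover, if $G$ has a positive spectral gap $\lambda_1=\inf\sigma(\Delta)>0$, then for any $a<2\lambda_1(p-1)$ there exists a constant $C>0$ (which may depend on $a$) such that $$\|\mathcal{H}_af\|_{\ell^p(E,\mu)}\le C\|f\|_{\ell^p(V,\nu)}\quad\text{for all } f\in\mathcal{C}_0(V).$$
   Context: A weighted graph $G=(V,E,\nu,\mu)$ consists of a connected, locally finite, undirected graph $(V,E)$ (each vertex has finitely many neighbors; $x\sim y$ means $\{x,y\}\in E$), vertex weights $\nu:V\to(0,\infty)$, $x\mapsto\nu_x$, and symmetric edge weights $\mu:E\to(0,\infty)$, $\{x,y\}\mapsto\mu_{xy}=\mu_{yx}$, extended to $V\times V$ by $\mu_{xy}=0$ if $\{x,y\}\notin E$. Put $\deg_x:=\sum_{y\in V}\mu_{xy}$. $\mathcal{C}_0(V)$ denotes the finitely supported real functions on $V$. The spaces $\ell^p(V,\nu)$ and $\ell^p(E,\mu)$ are the usual $\ell^p$ spaces over the discrete measure spaces $(V,\nu)$ and $(E,\mu)$. The Laplacian is $\Delta f(x)=\frac1{\nu_x}\sum_{y}\mu_{xy}(f(x)-f(y))$; when $\sup_x\deg_x/\nu_x<\infty$ it is a bounded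 nonnegative self-adjoint operator on $\ell^2(V,\nu)$, with $\ell^2(V,\nu)$-spectrum $\sigma(\Delta)$, and it generates the semigroup $e^{-t\Delta}$ acting on $\ell^p(V,\nu)$, $p\in[1,\infty]$. For $f:V\to\mathbb{R}$, $|Df|:E\to\mathbb{R}$ is defined by $|Df|(\{x,y\})=|f(x)-f(y)|$. For $f\in\mathcal{C}_0(V)$, $a\in\mathbb{R}$ and $\{x,y\}\in E$, define $$(\mathcal{H}f)(\{x,y\}):=\left(\int_0^\infty |D(e^{-t\Delta}f)|^2(\{x,y\})\,dt\right)^{1/2},\qquad (\mathcal{H}_af)(\{x,y\}):=\left(\int_0^\infty e^{at}|D(e^{-t\Delta}f)|^2(\{x,y\})\,dt\right)^{1/2}.$$ *)

(* Defs.v *)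
From mathcomp Require Import all_boot all_order all_algebra.
From mathcomp Require Import all_classical all_reals all_analysis.
Set Implicit Arguments.
Unset Strict Implicit.
Unset Printing Implicit Defensive.
Import Order.TTheory GRing.Theory Num.Theory.
Import numFieldNormedType.Exports.
Local Open Scope classical_set_scope.
Local Open Scope ring_scope.

(** An edge is the set [set x; y] of its endpoints; loops are not excluded.
    [edge_weight] is only meaningful on [edges]. *)
Record weighted_graph (R : realType) (V : choiceType) := WeightedGraph {
  edges : set (set V);
  edgesP : forall e, edges e -> exists x y, e = [set x; y];
  adj : rel V := fun x y => [set x; y] \in edges;
  graph_connected : forall x y, exists2 s : seq V, path adj x s & last x s = y;
  locally_finite : forall x, finite_set [set y | adj x y];
  vertex_weight : V -> R;
  vertex_weight_gt0 : forall x, 0 < vertex_weight x;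
  edge_weight : set V -> R;
  edge_weight_gt0 : forall e, edges e -> 0 < edge_weight e
}.

Section Graph.
Context {R : realType} {V : choiceType}.
Implicit Types (G : weighted_graph R V) (f : V -> R) (e : set V).

Definition mu G (x y : V) : R :=
  if adj G x y then edge_weight G [set x; y] else 0.

(** The sums over [setT] have finite support by local finiteness. *)
Definition deg G (x : V) : R := \sum_(y \in [set: V]) mu G x y.

Definition laplacian G f (x : V) : R :=
  (vertex_weight G x)^-1 * \sum_(y \in [set: V]) mu G x y * (f x - f y).

(** [M = sup_x deg_x / nu_x], as an extended real. *)
Definition sup_deg G : \bar R :=
  ereal_sup [set (deg G x / vertex_weight G x)%:E | x in [set: V]].

Definition finitely_supported f : Prop := finite_set [set x | f x != 0].

(** The norm of the l^p space over the discrete measure space (A, w), for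
    0 < p < oo; it is +oo outside of that space. *)
Definition lp_norm (T : choiceType) (A : set T) (w : T -> R) (p : R)
    (g : T -> \bar R) : \bar R :=
  ((\esum_(i in A) ((w i)%:E * `|g i| `^ p)) `^ p^-1)%E.

Definition lpV_norm G (p : R) f : \bar R :=
  lp_norm [set: V] (vertex_weight G) p (EFin \o f).

Definition lpE_norm G (p : R) (g : set V -> \bar R) : \bar R :=
  lp_norm (edges G) (edge_weight G) p g.

Definition l2V G f : Prop := (lpV_norm G 2 f < +oo)%E.

(** [l] is in the resolvent set when [laplacian G - l] is a bijection of
    l^2(V, nu) onto itself with bounded inverse (linearity of the inverse [S] is
    then automatic). The Laplacian being self-adjoint, only real [l] matter. *)
Definition resolvent_set G : set R := [set l |
  exists (S : (V -> R) -> (V -> R)) (C : R), forall f, l2V G f ->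
    [/\ (lpV_norm G 2 (S f) <= C%:E * lpV_norm G 2 f)%E,
        S (fun x => laplacian G f x - l * f x) = f &
        (fun x => laplacian G (S f) x - l * S f x) = f]].

Definition spectrum G : set R := ~` resolvent_set G.

Definition lambda1 G : R := inf (spectrum G).

(** The semigroup [e^{-t Delta}]. When [sup_deg G] is finite the Laplacian is
    bounded on every l^p(V, nu), 1 <= p <= oo, so the semigroup it generates is
    the exponential series, whose norm convergence implies pointwise
    convergence. *)
Definition heat G (t : R) f (x : V) : R :=
  limn (series (fun n => (- t) ^+ n / n`!%:R * iter n (laplacian G) f x)).

(** [|Df|] at the edge {x, y} is the real number |f x - f y| (see [gradE]). *)
Definition grad f e : R :=
  xget 0 [set r | exists x y, e = [set x; y] /\ r = `|f x - f y|].

Lemma gradE f x y : grad f [set x; y] = `|f x - f y|.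
Proof.
rewrite /grad; case: xgetP => [r _ [a [b [ab ->]]]|/(_ `|f x - f y|)].
  have xab : [set a; b] x by rewrite -ab; left.
  have yab : [set a; b] y by rewrite -ab; right.
  have axy : [set x; y] a by rewrite ab; left.
  have bxy : [set x; y] b by rewrite ab; right.
  case: xab => /= xE; case: yab => /= yE; case: axy => /= aE; case: bxy => /= bE;
    by subst; first [done | rewrite distrC].
by case; exists x, y.
Qed.

Definition calH G f e : \bar R :=
  ((\int[lebesgue_measure]_(t in `[0%R, +oo[)
      ((grad (heat G t f) e) ^+ 2)%:E) `^ 2^-1)%E.

Definition calHa G (a : R) f e : \bar R :=
  ((\int[lebesgue_measure]_(t in `[0%R, +oo[)
      (expR (a * t) * (grad (heat G t f) e) ^+ 2)%:E) `^ 2^-1)%E.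

End Graph.

(* Main.v *)
Require Import Defs.
From mathcomp Require Import all_boot all_order all_algebra finmap.
From mathcomp Require Import all_classical all_reals all_analysis.
From mathcomp Require Import measurable_realfun ring lra.
Set Implicit Arguments.
Unset Strict Implicit.
Unset Printing Implicit Defensive.
Import Order.TTheory GRing.Theory Num.Theory.
Import numFieldNormedType.Exports.
Local Open Scope classical_set_scope.
Local Open Scope ring_scope.

(** Why the theorem holds.  The proof is Stein's argument for Littlewood-Paley
    functions with exponent at most 2, carried out in discrete time.

    For a small step [tau] the operator [P = 1 - tau Delta] is a lazy symmetric
    Markov kernel, and [exp (-t Delta) f] is the average of the iterates [P^k f]
    over the law of a Poisson variable of mean [t / tau] ([heat_poisson]).  By
    Jensen's inequality and a Gamma integral, [(H_a f)^2] at an edge is at most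
    [tau r] times the discrete square function [sum_k r^k |D P^k f|^2], where
    [r = 1 / (1 - a tau)] ([integral_grad_heat_le]).  It remains to bound the
    latter in [l^p]; only finitely many terms, finitely many edges, and hence
    finitely many vertices matter, so that everything takes place on the
    restriction of the kernel to a finite set, where row sums are at most 1.

    A signed [f] is the difference of two nonnegative functions, so let
    [f >= 0].  Strict convexity of the [p]-th power bounds
    [|D P^k f|^2 (x, y)] by a multiple of [W^(2-p)] times the defects at [x] and
    [y] of the tangent line at [P^(k+1) f (x)], where [W] dominates all the
    iterates ([sqr_diff_le_defect]).  These defects make up the deficit in
    Jensen's inequality for [P], and their weighted sum over the edges is at most
    three times the loss [||P^k f||_p^p - ||P^(k+1) f||_p^p] ([defect_sum]).  Hoelder's inequality
    with exponents [2 / (2 - p)] and [2 / p] then bounds the square function by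
    the norm of [W] and by the weighted sum of the losses
    ([square_function_ge0]).

    The maximal function is controlled by Rota's theorem ([maximal_even]): the
    function [P^(2n) f] is the expectation, given [X_0], of the value at time
    [n] of a reversed martingale, to which Doob's inequality applies.  The
    inequality is proved by dynamic programming with the function [U] of
    [doob_step].

    For [a = 0] the losses telescope.  Under a spectral gap [lambda1], the form
    of [Delta] is at least [lambda1] ([spectral_gap_form]), which makes [P] a
    contraction of [l^2]; by interpolation with [l^1] ([lp_mass_gap]) the sequence
    [||P^k f||_p^p] decays geometrically with ratio at most
    [1 - 2 lambda1 (p - 1) tau (1 - tau M)].  Since [a < 2 lambda1 (p - 1)], this
    ratio is smaller than [1 - a tau = 1 / r] for small [tau], and the weighted
    sum of the losses is finite. *)

(** * Powers of nonnegative reals *)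

Section Scalar.
Context {R : realType}.
Implicit Types a b s m w x y t p : R.

Lemma powR_split x t : 0 <= x -> 0 < t -> x `^ (1 - t) * x `^ t = x.
Proof.
move=> x0 t0; have [->|xn] := eqVneq x 0.
  by rewrite (powR0 (x := t)) ?mulr0// gt_eqF.
by rewrite -powRD ?xn ?implybT// subrK powRr1.
Qed.

Lemma le_powR x y t : 0 <= t -> 0 <= x -> x <= y -> x `^ t <= y `^ t.
Proof.
move=> t0 x0 xy; apply: ge0_ler_powR => //; rewrite nnegrE//.
exact: le_trans xy.
Qed.

Lemma powR_maxD x y p : 0 <= x -> 0 <= y -> Num.max x y `^ p <= x `^ p + y `^ p.
Proof.
move=> x0 y0; by case: (leP x y) => _; [rewrite lerDr|rewrite lerDl]; exact: powR_ge0.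
Qed.

Lemma powR_addD x y p : 0 <= x -> 0 <= y -> 0 <= p ->
  (2 * x + 2 * y) `^ p <= 4 `^ p * (x `^ p + y `^ p).
Proof.
move=> x0 y0 p0; have m0 : 0 <= Num.max x y by rewrite le_max x0.
apply: (@le_trans _ _ ((4 * Num.max x y) `^ p)).
  apply: le_powR => //; first by rewrite addr_ge0 ?mulr_ge0.
  have : x <= Num.max x y by rewrite le_max lexx.
  have : y <= Num.max x y by rewrite le_max lexx orbT.
  by lra.
by rewrite powRM// ler_wpM2l ?powR_ge0// powR_maxD.
Qed.

Lemma young_powR a b t : 0 <= a -> 0 <= b -> 0 <= t <= 1 ->
  a `^ t * b `^ (1 - t) <= t * a + (1 - t) * b.
Proof.
move=> a0 b0 /andP[]; rewrite le_eqVlt => /predU1P[<- _|t0].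
  by rewrite powRr0 subr0 powRr1// !mul1r mul0r add0r.
rewrite le_eqVlt => /predU1P[->|t1].
  by rewrite subrr powRr0 powRr1// mul1r mulr1 mul0r addr0.
have u0 : 0 < 1 - t by rewrite subr_gt0.
have := @conjugate_powR R (a `^ t) (b `^ (1 - t)) t^-1 (1 - t)^-1
  (powR_ge0 _ _) (powR_ge0 _ _).
rewrite !invr_gt0 !invrK -!powRrM !divff ?gt_eqF// !powRr1// => H.
have := H t0 u0; rewrite addrC subrK => /(_ erefl).
by rewrite [a * t]mulrC [b * _]mulrC.
Qed.

Lemma mul_powRB1 a p : 0 <= a -> 0 < p -> a `^ (p - 1) * a = a `^ p.
Proof. by move=> a0 p0; rewrite mulrC mulr_powRB1. Qed.

Lemma powRV a p : 0 <= a -> a^-1 `^ p = (a `^ p)^-1.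
Proof. by move=> a0; rewrite -powR_inv1// -powRrM mulN1r powRN. Qed.

(** Young's inequality for the conjugate exponents [p / (p - 1)] and [p]; both
    properties of the function [U] below reduce to it. *)
Lemma young_pred m s p : 0 <= m -> 0 <= s -> 1 <= p ->
  p * (m `^ (p - 1) * s) <= (p - 1) * m `^ p + s `^ p.
Proof.
move=> m0 s0 p1; have p0 : 0 < p by lra.
have := @young_powR (m `^ p) (s `^ p) ((p - 1) / p) (powR_ge0 _ _) (powR_ge0 _ _).
have -> : 1 - (p - 1) / p = p^-1 by field; rewrite gt_eqF.
rewrite -!powRrM divff ?gt_eqF// powRr1// [p * (_ / _)]mulrC divfK ?gt_eqF//.
move=> /(_ _)/wrap[].
  rewrite divr_ge0 ?ler_pdivrMr ?mul1r//; lra.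
move/(ler_wpM2l (ltW p0)) => /le_trans; apply.
rewrite mulrDr !mulrA [p * (p - 1)]mulrC mulfK ?gt_eqF// divff ?gt_eqF// mul1r.
by [].
Qed.

(** Strict convexity, quantified: the second derivative of the power is only of
    order [w `^ (p - 2)] at height [w], hence the factor on the right.  Once the
    mixed powers of [s] and [m] are estimated by [young_powR], what remains is
    an identity between polynomials. *)
Lemma convex_defect s m w p : 0 <= s -> 0 <= m -> s <= w -> m <= w ->
  1 < p -> p <= 2 ->
  (p - 1) ^+ 2 * (s - m) ^+ 2 <=
  w `^ (2 - p) * (s `^ p - m `^ p - p * m `^ (p - 1) * (s - m)).
Proof.
move=> s0 m0 sw mw p1 p2.
have p0 : 0 < p by lra.
pose q := p - 1; have q0 : 0 < q by rewrite subr_gt0.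
have q1 : q <= 1 by rewrite /q; lra.
have qq : 2 - p = 1 - q by rewrite /q; ring.
have key x (x0 : 0 <= x) := powR_split x0 q0.
have defE : s `^ p - m `^ p - p * m `^ (p - 1) * (s - m)
  = s `^ q * s - m `^ q * ((1 + q) * s - q * m).
  by rewrite -(mul_powRB1 s0 p0) -(mul_powRB1 m0 p0) -/q /q; ring.
have main : (p - 1) ^+ 2 * (s - m) ^+ 2 <= (Num.max s m) `^ (2 - p) *
    (s `^ q * s - m `^ q * ((1 + q) * s - q * m)).
  rewrite -/q qq; case: (leP m s) => [ms|/ltW sm].
    rewrite mulrBr [X in _ <= X - _]mulrA key// [X in _ <= _ - X]mulrA.
    have H := @young_powR m s q m0 s0; rewrite (ltW q0) q1 in H.
    have {H} := H isT => H.
    have c0 : 0 <= (1 + q) * s - q * m by nra.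
    have := ler_wpM2r c0 H => H'.
    rewrite [s `^ _ * m `^ _]mulrC; nra.
  have [m00|mn] := eqVneq m 0.
    have -> : s = 0 by lra.
    by rewrite m00 (powR0 (x := q)) ?gt_eqF// !mul0r !subrr mulr0 expr0n mulr0.
  rewrite mulrBr [X in _ <= _ - X]mulrA key// [X in _ <= X - _]mulrA.
  have mp : 0 < m by rewrite lt_def mn.
  have H := @young_powR m s q m0 s0; rewrite (ltW q0) q1 in H.
  have {H} := H isT; set D := q * m + _ => H.
  have q1' : 0 <= 1 - q by lra.
  have Dp : 0 < D by by apply: ltr_pwDl; [exact: mulr_gt0|exact: mulr_ge0].
  have ms0 : 0 <= m - s by lra.
  have Dm : D <= m by rewrite /D -subr_ge0 (_ : _ - _ = (1 - q) * (m - s)) ?mulr_ge0//; ring.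
  set A := m `^ _ * s `^ q.
  have A0 : 0 <= A by rewrite mulr_ge0// powR_ge0.
  (* the two mixed powers multiply to [s * m], so an upper bound for one is
     a lower bound for the other *)
  have AB : s * m = A * (m `^ q * s `^ (1 - q)).
    by rewrite -{1}(key _ s0) -{1}(key _ m0) /A; ring.
  have AD : s * m <= A * D by rewrite AB ler_wpM2l.
  have e1 : q ^+ 2 * (s - m) ^+ 2 * m <= (A * s - m * ((1 + q) * s - q * m)) * m.
    have F : 0 <= A * s - m * ((1 + q) * s - q * m) - q ^+ 2 * (s - m) ^+ 2.
      rewrite -(pmulr_lge0 _ Dp).
      have := ler_wpM2r s0 AD => H1.
      have h2 : 0 <= (m - D) * (q ^+ 2 * (s - m) ^+ 2).
        by rewrite mulr_ge0 ?subr_ge0// mulr_ge0// sqr_ge0.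
      have : s * m * s - D * m * ((1 + q) * s - q * m)
             - m * (q ^+ 2 * (s - m) ^+ 2) = 0 by rewrite /D; ring.
      nra.
    rewrite ler_pM2r//; lra.
  by rewrite ler_pM2r in e1.
rewrite defE (le_trans main)// ler_wpM2r//; last first.
  rewrite ge0_ler_powR// ?nnegrE ?le_max ?s0// ?ge_max ?sw ?mw//; try lra.
have [z|z] := eqVneq (Num.max s m) 0.
  have sz : s = 0 by apply/eqP; rewrite eq_le s0 andbT -z le_max lexx.
  have mz : m = 0 by apply/eqP; rewrite eq_le m0 andbT -z le_max lexx orbT.
  by rewrite sz mz powR0 ?gt_eqF// !mulr0 mul0r subrr.
have zp : 0 < Num.max s m by rewrite lt_def z le_max s0.
rewrite -(pmulr_rge0 _ (powR_gt0 (2 - p) zp)) (le_trans _ main)//.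
by rewrite mulr_ge0// sqr_ge0.
Qed.

(** The endpoints [t = 0] and [t = 1] are included, by the convention
    [0 `^ 0 = 1]: they occur below for [p = 2]. *)
Lemma hoelder_sum (I : Type) (r : seq I) (w A B : I -> R) t :
  (forall i, 0 <= w i) -> (forall i, 0 <= A i) -> (forall i, 0 <= B i) ->
  0 <= t <= 1 ->
  \sum_(i <- r) w i * (A i `^ t * B i `^ (1 - t)) <=
  (\sum_(i <- r) w i * A i) `^ t * (\sum_(i <- r) w i * B i) `^ (1 - t).
Proof.
move=> w0 A0 B0 /andP[t0 t1].
set X := \sum_(i <- r) w i * A i; set Y := \sum_(i <- r) w i * B i.
have X0 : 0 <= X by apply: sumr_ge0 => i _; rewrite mulr_ge0.
have Y0 : 0 <= Y by apply: sumr_ge0 => i _; rewrite mulr_ge0.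
have [->|tn0] := eqVneq t 0.
  rewrite powRr0 subr0 powRr1// mul1r /Y ler_sum// => i _.
  by rewrite powRr0 mul1r powRr1.
have [->|tn1] := eqVneq t 1.
  rewrite subrr powRr0 powRr1// mulr1 /X ler_sum// => i _.
  by rewrite powRr0 mulr1 powRr1.
have un : 1 - t != 0 by rewrite subr_eq0 eq_sym.
have u0 : 0 <= 1 - t by lra.
have zero (l : seq I) (C : I -> R) : (forall i, 0 <= C i) -> forall s, s != 0 ->
    \sum_(i <- l) w i * C i = 0 -> forall f : I -> R,
    \sum_(i <- l) w i * (C i `^ s * f i) = 0.
  move=> C0 s sn; elim: l => [|i l IH] E f; first by rewrite big_nil.
  move: E; rewrite !big_cons => E.
  have h1 : 0 <= w i * C i by rewrite mulr_ge0.
  have h2 : 0 <= \sum_(j <- l) w j * C j.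
    by apply: sumr_ge0 => j _; rewrite mulr_ge0.
  have e1 : w i * C i = 0 by lra.
  rewrite IH ?addr0; last lra.
  move/eqP: e1; rewrite mulf_eq0 => /orP[/eqP->|/eqP->]; first by rewrite mul0r.
  by rewrite powR0// mul0r mulr0.
have [X00|Xn] := eqVneq X 0.
  by rewrite zero// mulr_ge0 ?powR_ge0.
have [Y00|Yn] := eqVneq Y 0.
  under eq_bigr do rewrite [A _ `^ _ * _]mulrC.
  by rewrite zero// mulr_ge0 ?powR_ge0.
have Xp : 0 < X by rewrite lt_def Xn.
have Yp : 0 < Y by rewrite lt_def Yn.
have PP : 0 < X `^ t * Y `^ (1 - t) by rewrite mulr_gt0// powR_gt0.
rewrite -[leRHS]mulr1 -ler_pdivrMl//.
rewrite mulr_sumr (@le_trans _ _ (\sum_(i <- r) (t * (w i * A i / X)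
   + (1 - t) * (w i * B i / Y))))//.
  apply: ler_sum => i _.
  have -> : (X `^ t * Y `^ (1 - t))^-1 * (w i * (A i `^ t * B i `^ (1 - t)))
    = w i * ((A i / X) `^ t * (B i / Y) `^ (1 - t)).
    by rewrite !powRM ?invr_ge0// !powRV// invfM; ring.
  have := @young_powR (A i / X) (B i / Y) t (divr_ge0 (A0 i) X0)
    (divr_ge0 (B0 i) Y0).
  rewrite t0 t1 => /(_ isT)/(ler_wpM2l (w0 i))/le_trans; apply.
  by rewrite le_eqVlt; apply/orP; left; apply/eqP; ring.
rewrite big_split/= -!mulr_sumr -!mulr_suml -/X -/Y !divff//.
lra.
Qed.

(** The Bellman function [U] of Doob's inequality: [s] is the present value of a
    nonnegative martingale and [m] its running maximum.  It is affine in [s],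
    hence stable under averaging; by [doob_step] updating the maximum does not
    increase it, and by [doob_terminal] it dominates the final cost [m `^ p] up
    to a multiple of [s `^ p]. *)
Lemma doob_step s m p : 0 <= s -> 0 <= m -> 1 < p ->
  let U x := p * x `^ p - p * (p / (p - 1)) * x `^ (p - 1) * s in
  U (Num.max m s) <= U m.
Proof.
move=> s0 m0 p1 /=; case: (leP s m) => // /ltW ms.
have p0 : 0 < p by lra.
have q0 : 0 < p - 1 by lra.
have H := young_pred m0 s0 (ltW p1).
rewrite -(ler_pM2l q0).
have -> : (p - 1) * (p * s `^ p - p * (p / (p - 1)) * s `^ (p - 1) * s)
   = p * ((p - 1) * s `^ p) - p * p * (s `^ (p - 1) * s).
  by field; rewrite gt_eqF.
have -> : (p - 1) * (p * m `^ p - p * (p / (p - 1)) * m `^ (p - 1) * s)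
   = p * ((p - 1) * m `^ p) - p * (p * (m `^ (p - 1) * s)).
  by field; rewrite gt_eqF.
rewrite mul_powRB1//; nra.
Qed.

Lemma doob_terminal s m p : 0 <= s -> 0 <= m -> 1 < p ->
  m `^ p <= p * m `^ p - p * (p / (p - 1)) * m `^ (p - 1) * s
            + (p / (p - 1)) `^ p * s `^ p.
Proof.
move=> s0 m0 p1.
have q0 : 0 <= p / (p - 1) by rewrite divr_ge0//; lra.
rewrite -powRM//.
have := young_pred m0 (mulr_ge0 q0 s0) (ltW p1).
nra.
Qed.

End Scalar.

(** * Symmetric kernels on a finite set and Rota's maximal theorem *)

(** Row sums may be below 1, because restricting a Markov kernel to a finite set
    of vertices removes mass. *)
Record symmetric_kernel (R : realType) (T : finType) (nu : T -> R)
    (k : T -> T -> R) : Prop := SymmetricKernel {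
  kernel_nu_ge0 : forall x, 0 <= nu x;
  kernel_ge0 : forall x y, 0 <= k x y;
  kernel_sym : forall x y, nu x * k x y = nu y * k y x;
  kernel_sub : forall x, \sum_y k x y <= 1
}.

Section Kernel.
Context {R : realType} {T : finType} (nu : T -> R) (k : T -> T -> R).
Hypothesis ker : symmetric_kernel nu k.
Implicit Types (f g h : T -> R) (p : R) (n : nat).

Definition kop g (x : T) : R := \sum_y k x y * g y.

Let nu0 := kernel_nu_ge0 ker.
Let k0 := kernel_ge0 ker.

Lemma kop_ge0 g : (forall x, 0 <= g x) -> forall x, 0 <= kop g x.
Proof. by move=> g0 x; apply: sumr_ge0 => y _; rewrite mulr_ge0. Qed.

Lemma iter_kop_ge0 n g : (forall x, 0 <= g x) ->
  forall x, 0 <= iter n kop g x.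
Proof. by move=> g0; elim: n => //= n IH; exact: kop_ge0. Qed.

Lemma kop_le g h : (forall x, g x <= h x) -> forall x, kop g x <= kop h x.
Proof. by move=> gh x; apply: ler_sum => y _; rewrite ler_wpM2l. Qed.

Lemma eq_kop g h : g =1 h -> kop g =1 kop h.
Proof. by move=> gh x; apply: eq_bigr => y _; rewrite gh. Qed.

Lemma eq_iter_kop n g h : g =1 h -> iter n kop g =1 iter n kop h.
Proof. by move=> gh; elim: n => //= n IH; exact: eq_kop. Qed.

Lemma kopD g h x : kop (fun y => g y + h y) x = kop g x + kop h x.
Proof. by rewrite /kop -big_split/=; apply: eq_bigr => y _; rewrite mulrDr. Qed.

Lemma kopZ c g x : kop (fun y => c * g y) x = c * kop g x.
Proof. by rewrite /kop mulr_sumr; apply: eq_bigr => y _; rewrite mulrCA. Qed.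

Lemma iter_kopD n g h x :
  iter n kop (fun y => g y + h y) x = iter n kop g x + iter n kop h x.
Proof.
elim: n x => //= n IH x; rewrite -kopD; exact: eq_kop.
Qed.

Lemma kop_cst_le c x : 0 <= c -> kop (fun=> c) x <= c.
Proof.
move=> c0; rewrite /kop -mulr_suml -[leRHS]mul1r ler_wpM2r//.
exact: kernel_sub ker x.
Qed.

Lemma kop_adj g h :
  \sum_x nu x * (g x * kop h x) = \sum_x nu x * (kop g x * h x).
Proof.
transitivity (\sum_x \sum_y nu x * k x y * (g x * h y)).
  apply: eq_bigr => x _; rewrite !mulr_sumr.
  by apply: eq_bigr => y _; ring.
rewrite exchange_big/=; apply: eq_bigr => y _.
rewrite mulr_suml mulr_sumr; apply: eq_bigr => x _.
by rewrite (kernel_sym ker); ring.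
Qed.

Lemma iter_kop_adj n g h :
  \sum_x nu x * (g x * iter n kop h x) = \sum_x nu x * (iter n kop g x * h x).
Proof.
elim: n g h => // n IH g h.
by rewrite iterS kop_adj IH -iterSr.
Qed.

Lemma kop_mass g : \sum_x nu x * kop g x = \sum_x nu x * (kop (fun=> 1) x * g x).
Proof.
by rewrite -kop_adj; apply: eq_bigr => x _; rewrite mul1r.
Qed.

Lemma kop_mass_le g : (forall x, 0 <= g x) ->
  \sum_x nu x * kop g x <= \sum_x nu x * g x.
Proof.
move=> g0; rewrite kop_mass; apply: ler_sum => x _.
rewrite ler_wpM2l// ler_piMl//; exact: kop_cst_le.
Qed.

Definition tangent_defect p (s m : R) : R :=
  s `^ p - m `^ p - p * m `^ (p - 1) * (s - m).

Lemma tangent_defect_ge0 p s m : 1 < p -> p <= 2 -> 0 <= s -> 0 <= m ->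
  0 <= tangent_defect p s m.
Proof.
move=> p1 p2 s0 m0.
have [z|z] := eqVneq (Num.max s m) 0.
  have sz : s = 0 by apply/eqP; rewrite eq_le s0 andbT -z le_max lexx.
  have mz : m = 0 by apply/eqP; rewrite eq_le m0 andbT -z le_max lexx orbT.
  by rewrite /tangent_defect sz mz !subrr mulr0 subr0.
have zp : 0 < Num.max s m by rewrite lt_def z le_max s0.
rewrite -(pmulr_rge0 _ (powR_gt0 (2 - p) zp)).
apply: le_trans (convex_defect s0 m0 _ _ p1 p2); rewrite ?le_max ?lexx ?orbT//.
by rewrite mulr_ge0// sqr_ge0.
Qed.

(** Jensen's inequality with its deficit: the tangent is taken at the mean, so
    the linear terms cancel up to the missing mass of the row, and the latter
    contributes with the right sign because [1 < p]. *)
Lemma kop_deficit p g x : 1 < p -> (forall y, 0 <= g y) ->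
  \sum_y k x y * tangent_defect p (g y) (kop g x) <=
  kop (fun y => g y `^ p) x - kop g x `^ p.
Proof.
move=> p1 g0; set m := kop g x; have m0 : 0 <= m by exact: kop_ge0.
have p0 : 0 < p by lra.
pose c := \sum_y k x y.
have -> : \sum_y k x y * tangent_defect p (g y) m =
    kop (fun y => g y `^ p) x - c * m `^ p - p * m `^ (p - 1) * (m - c * m).
  transitivity (\sum_y (k x y * g y `^ p - k x y * m `^ p
     - p * m `^ (p - 1) * (k x y * g y - k x y * m))).
    by apply: eq_bigr => y _; rewrite /tangent_defect; ring.
  by rewrite !sumrB -mulr_sumr !sumrB -!mulr_suml.
have e : m `^ (p - 1) * m = m `^ p by exact: mul_powRB1.
have -> : p * m `^ (p - 1) * (m - c * m) = p * (1 - c) * m `^ p.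
  by rewrite -e; ring.
have : 0 <= (p - 1) * ((1 - c) * m `^ p).
  rewrite mulr_ge0 ?subr_ge0 ?(ltW p1)// mulr_ge0 ?powR_ge0// subr_ge0.
  exact: kernel_sub ker x.
by lra.
Qed.

Lemma kop_jensen p g x : 1 < p -> p <= 2 -> (forall y, 0 <= g y) ->
  kop g x `^ p <= kop (fun y => g y `^ p) x.
Proof.
move=> p1 p2 g0; rewrite -subr_ge0; apply: le_trans (kop_deficit x p1 g0).
apply: sumr_ge0 => y _; rewrite mulr_ge0// tangent_defect_ge0//.
exact: kop_ge0.
Qed.

Lemma iter_kop_jensen n p g x : 1 < p -> p <= 2 -> (forall y, 0 <= g y) ->
  iter n kop g x `^ p <= iter n kop (fun y => g y `^ p) x.
Proof.
move=> p1 p2 g0; elim: n x => //= n IH x.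
apply: le_trans (kop_jensen x p1 p2 _) _; first exact: iter_kop_ge0.
exact: kop_le.
Qed.

Section Maximal.
Variables (p : R) (f : T -> R) (j : T -> nat).
Hypotheses (p1 : 1 < p) (p2 : p <= 2) (f0 : forall x, 0 <= f x).

Let at_ n x : R := (j x == n)%:R.
Let after n x : R := (n < j x)%N%:R.
Let a n := iter n kop f.
Let Q := (p / (p - 1)) `^ p.

(** Let the chain run from [X_n = x] back to [X_0].  Then [doob_sum n x] is the
    expectation of [a i (X_i) `^ p] at the time [i = j (X_0)], restricted to the
    event that this time is at most [n]. *)
Let Fixpoint doob_sum n : T -> R :=
  match n with
  | 0 => fun x => f x `^ p * at_ 0 x
  | n.+1 => fun x => kop (doob_sum n) x + a n.+1 x `^ p * iter n.+1 kop (at_ n.+1) x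
  end.

Let at0 n x : 0 <= at_ n x. Proof. by []. Qed.
Let after0 n x : 0 <= after n x. Proof. by []. Qed.

Lemma afterS n x : after n x = at_ n.+1 x + after n.+1 x.
Proof.
rewrite /after /at_ [(n < _)%N]leq_eqVlt eq_sym.
by case: ltngtP => //= _; rewrite ?addr0 ?add0r.
Qed.

(** Dynamic programming: [m] is the maximum of the martingale [a i (X_i)] over
    the times [i > n], already explored, and its power [m `^ p] is the cost when
    [j (X_0) > n].
    The statement has to hold for all [m] because one more step replaces [m] by
    its maximum with [a n.+1 x]. *)
Lemma doob_bellman n m x : 0 <= m ->
  doob_sum n x + m `^ p * iter n kop (after n) x <=
  p * m `^ p - p * (p / (p - 1)) * m `^ (p - 1) * a n x
  + Q * iter n kop (fun y => f y `^ p) x.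
Proof.
have p0 : 0 < p := lt_trans ltr01 p1.
have max_le (b c : R) : 0 <= b -> 0 <= c ->
    b `^ p <= Num.max c b `^ p /\ c `^ p <= Num.max c b `^ p.
  move=> b0 c0.
  by split; apply: ge0_ler_powR; rewrite ?nnegrE ?(ltW p0) ?le_max ?b0 ?c0 ?lexx ?orbT.
elim: n m x => [|n IH] m x m0.
- set M := Num.max m (f x); rewrite /=; have M0 : 0 <= M by rewrite le_max m0.
  have [h1 h2] := max_le _ _ (f0 x) m0.
  apply: (@le_trans _ _ (M `^ p)).
    rewrite /after /at_ lt0n; have [_|_] := eqVneq (j x) 0%N => /=.
      by rewrite mulr1 mulr0 addr0.
    by rewrite mulr1 mulr0 add0r.
  apply: le_trans (doob_terminal (f0 x) M0 p1) _.
  rewrite lerD2r; exact: doob_step.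
have a0 : 0 <= a n.+1 x by exact: iter_kop_ge0.
set M := Num.max m (a n.+1 x).
have M0 : 0 <= M by rewrite le_max m0.
have [h1 h2] := max_le _ _ a0 m0.
apply: (@le_trans _ _ (kop (fun y => doob_sum n y + M `^ p * iter n kop (after n) y) x)).
  rewrite kopD kopZ -iterS /= -addrA lerD2l.
  have -> : kop (iter n kop (after n)) x =
      kop (iter n kop (at_ n.+1)) x + kop (iter n kop (after n.+1)) x.
    rewrite -!iterS -iter_kopD; apply: eq_iter_kop => y; exact: afterS.
  rewrite mulrDr lerD// ler_wpM2r//; first exact: (@iter_kop_ge0 n.+1).
  exact: (@iter_kop_ge0 n.+1).
apply: le_trans (kop_le (fun y => IH M y M0) x) _.
pose c := p * (p / (p - 1)) * M `^ (p - 1).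
apply: (@le_trans _ _ (p * M `^ p - c * a n.+1 x
    + Q * iter n.+1 kop (fun y => f y `^ p) x)).
  rewrite kopD kopZ -iterS lerD2r.
  have -> : kop (fun y => p * M `^ p - c * a n y) x
      = kop (fun=> p * M `^ p) x - c * a n.+1 x.
    by rewrite kopD -mulNr -[a n.+1 x]/(kop (a n) x) -kopZ; congr (_ + _);
      apply: eq_kop => y; rewrite mulNr.
  by rewrite lerD2r kop_cst_le// mulr_ge0 ?powR_ge0// ltW.
rewrite lerD2r; exact: doob_step.
Qed.

Lemma doob_sum_le n x : doob_sum n x <= Q * iter n kop (fun y => f y `^ p) x.
Proof.
have := @doob_bellman n 0 x (lexx _).
by rewrite !powR0 ?gt_eqF ?subr_gt0 ?(lt_trans ltr01)// !(mul0r, mulr0) subrr add0r addr0.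
Qed.

(** Row sums below 1 make the total mass of [doob_sum] leak.  What leaks at each
    step is controlled by [doob_sum_le] at that step, and the corresponding
    losses on the right-hand side telescope. *)
Lemma doob_total n :
  \sum_(i < n.+1) \sum_x nu x * (a i x `^ p * iter i kop (at_ i) x)
  - \sum_x nu x * doob_sum n x <=
  Q * (\sum_x nu x * f x `^ p - \sum_x nu x * iter n kop (fun y => f y `^ p) x).
Proof.
elim: n => [|n IH]; first by rewrite big_ord1 /= !subrr mulr0.
rewrite big_ord_recr/=.
have -> : \sum_x nu x * (kop (doob_sum n) x + a n.+1 x `^ p * iter n.+1 kop (at_ n.+1) x) =
   \sum_x nu x * kop (doob_sum n) x
   + \sum_x nu x * (a n.+1 x `^ p * iter n.+1 kop (at_ n.+1) x).
  by rewrite -big_split/=; apply: eq_bigr => x _; rewrite mulrDr.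
rewrite opprD addrACA [X in _ + X]addrC.
rewrite (kop_mass (doob_sum n)) (kop_mass (iter n kop _)) /=.
set c := fun x => kop (fun=> 1) x.
have H : \sum_x nu x * doob_sum n x - \sum_x nu x * (c x * doob_sum n x) <=
   Q * (\sum_x nu x * iter n kop (fun y => f y `^ p) x
        - \sum_x nu x * (c x * iter n kop (fun y => f y `^ p) x)).
  rewrite -!sumrB mulr_sumr; apply: ler_sum => x _.
  have c1 : c x <= 1 by exact: kop_cst_le.
  have := doob_sum_le n x => /(ler_wpM2l (mulr_ge0 (nu0 x) _)).
  move=> /(_ (1 - c x)); rewrite subr_ge0 => /(_ c1) h.
  by move: h; lra.
by lra.
Qed.

Lemma doob_total_le n :
  \sum_(i < n.+1) \sum_x nu x * (a i x `^ p * iter i kop (at_ i) x) <=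
  Q * \sum_x nu x * f x `^ p.
Proof.
have h1 := doob_total n.
have h2 : \sum_x nu x * doob_sum n x <=
    Q * \sum_x nu x * iter n kop (fun y => f y `^ p) x.
  rewrite mulr_sumr; apply: ler_sum => x _.
  by rewrite mulrCA ler_wpM2l// doob_sum_le.
by move: h1; rewrite mulrBr; lra.
Qed.

End Maximal.

(** Rota's maximal theorem for the even powers of a symmetric kernel. The
    function [(kop ^ 2n) f] is a conditional expectation of the reversed
    martingale [(kop ^ n) f (X_n)], so that Doob's inequality applies; the
    supremum over [n] is linearized by the choice [j] of a time at each point. *)
Lemma maximal_even p f (j : T -> nat) : 1 < p -> p <= 2 ->
  (forall x, 0 <= f x) ->
  \sum_x nu x * iter (j x).*2 kop f x `^ p <=
  (p / (p - 1)) `^ p * \sum_x nu x * f x `^ p.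
Proof.
move=> p1 p2 f0.
pose N := \max_x j x.
have jN x : (j x < N.+1)%N by rewrite ltnS /N; apply: leq_bigmax.
pose at_ n x : R := (j x == n)%:R.
apply: (@le_trans _ _ (\sum_(i < N.+1)
   \sum_x nu x * (iter i kop f x `^ p * iter i kop (at_ i) x))).
  under [leRHS]eq_bigr do rewrite iter_kop_adj.
  rewrite exchange_big/=; apply: ler_sum => x _.
  rewrite (bigD1 (Ordinal (jN x)))//= -[leLHS]addr0 lerD//.
    rewrite /at_ eqxx mulr1 ler_wpM2l// -addnn iterD.
    by apply: iter_kop_jensen => // y; apply: iter_kop_ge0.
  apply: sumr_ge0 => i _; rewrite mulr_ge0// mulr_ge0//.
  by apply: iter_kop_ge0 => y; exact: powR_ge0.
exact: doob_total_le.
Qed.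

End Kernel.

(** * The discrete square function on a finite set *)

Section SquareFunction.
Context {R : realType} {T : finType} (nu : T -> R) (k : T -> T -> R).
Hypothesis ker : symmetric_kernel nu k.
Variable p : R.
Hypotheses (p1 : 1 < p) (p2 : p <= 2).
Implicit Types (f g h : T -> R) (n : nat).

Let nu0 := kernel_nu_ge0 ker.
Let k0 := kernel_ge0 ker.
Let K := kop k.
Let Q := (p / (p - 1)) `^ p.
Let p0 : 0 < p := lt_trans ltr01 p1.

Definition lp_mass f : R := \sum_x nu x * `|f x| `^ p.

Lemma lp_mass_ge0 f : 0 <= lp_mass f.
Proof. by apply: sumr_ge0 => x _; rewrite mulr_ge0 ?powR_ge0. Qed.

Lemma lp_massE f : (forall x, 0 <= f x) -> lp_mass f = \sum_x nu x * f x `^ p.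
Proof. by move=> f0; apply: eq_bigr => x _; rewrite ger0_norm. Qed.

Lemma lp_mass_kop f : (forall x, 0 <= f x) -> lp_mass (K f) <= lp_mass f.
Proof.
move=> f0; rewrite !lp_massE//; last exact: kop_ge0 ker _ f0.
apply: le_trans (kop_mass_le ker (fun x => powR_ge0 (f x) p)).
by apply: ler_sum => x _; rewrite ler_wpM2l// (kop_jensen ker).
Qed.

(** Odd iterates of [f] are even iterates of [K f]. *)
Lemma maximal_function f n : (forall x, 0 <= f x) ->
  exists W : T -> R, [/\ forall x, 0 <= W x,
    forall i x, (i <= n)%N -> iter i K f x <= W x &
    \sum_x nu x * W x `^ p <= 2 * Q * lp_mass f].
Proof.
move=> f0.
have it0 i x : 0 <= iter i K f x by exact: (iter_kop_ge0 ker).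
pose j x := [arg max_(i > (ord0 : 'I_n.+1)) iter i K f x]%O.
exists (fun x => iter (j x) K f x); split=> [x|i x|]; first exact: it0.
  rewrite -ltnS => i_n; rewrite /j; case: arg_maxP => //= m _ Hm.
  exact: (Hm (Ordinal i_n)).
have Kf0 : forall x, 0 <= K f x by exact: kop_ge0 ker _ f0.
have h1 := @maximal_even _ _ _ _ ker p f (fun x => (j x)./2) p1 p2 f0.
have h2 := @maximal_even _ _ _ _ ker p (K f) (fun x => (j x)./2) p1 p2 Kf0.
have Q0 : 0 <= Q by exact: powR_ge0.
have := lp_mass_kop f0; rewrite (lp_massE Kf0) => /(ler_wpM2l Q0) h3.
apply: (@le_trans _ _ (\sum_x nu x * (iter (j x)./2.*2 K f x `^ p
    + iter (j x)./2.*2 K (K f) x `^ p))).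
  apply: ler_sum => x _; rewrite ler_wpM2l//.
  have -> : iter (j x) K f x = iter (odd (j x) + (j x)./2.*2) K f x.
    by rewrite odd_double_half.
  case: (odd (j x)); last by rewrite add0n lerDl powR_ge0.
  by rewrite add1n iterSr lerDr powR_ge0.
rewrite (eq_bigr _ (fun x _ => mulrDr _ _ _)) big_split/=.
have e : lp_mass f = \sum_x nu x * f x `^ p by exact: lp_massE.
move: h1 h2 h3; rewrite -/Q -e -/K; lra.
Qed.

Hypothesis lazy : forall x, 2^-1 <= k x x.

Let defect g x y := tangent_defect p (g x) (K g x) + tangent_defect p (g y) (K g x).

Let defect_ge0 g x y : (forall x, 0 <= g x) -> 0 <= defect g x y.
Proof.
by move=> g0; rewrite addr_ge0// tangent_defect_ge0//; exact: kop_ge0 ker _ g0 _.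
Qed.

(** Laziness controls the fluctuation [g x - K g x] at the base point by the
    deficit in Jensen's inequality. *)
Lemma defect_sum g : (forall x, 0 <= g x) ->
  \sum_x \sum_y nu x * k x y * defect g x y <= 3 * (lp_mass g - lp_mass (K g)).
Proof.
move=> g0; have Kg0 : forall x, 0 <= K g x by exact: kop_ge0 ker _ g0.
apply: (@le_trans _ _ (\sum_x nu x *
   (3 * (kop k (fun y => g y `^ p) x - K g x `^ p)))).
  apply: ler_sum => x _; rewrite -(eq_bigr _ (fun y _ => mulrA _ _ _)) -mulr_sumr.
  rewrite ler_wpM2l//.
  have := kop_deficit ker x p1 g0.
  set D := \sum_y _ => HD.
  have td0 y : 0 <= tangent_defect p (g y) (K g x) by exact: tangent_defect_ge0.
  have Dx : k x x * tangent_defect p (g x) (K g x) <= D.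
    rewrite /D (bigD1 x)//= lerDl; apply: sumr_ge0 => y _.
    by rewrite mulr_ge0.
  have h := ler_wpM2r (td0 x) (lazy x).
  have s := ler_wpM2r (td0 x) (kernel_sub ker x).
  rewrite (eq_bigr _ (fun y _ => mulrDr _ _ _)) big_split/= -mulr_suml -/D.
  by move: HD Dx h s; rewrite -/K; lra.
rewrite (eq_bigr _ (fun x _ => mulrCA _ _ _)) -mulr_sumr ler_wpM2l//.
rewrite (eq_bigr _ (fun x _ => mulrBr _ _ _)) sumrB (lp_massE g0) (lp_massE Kg0).
rewrite lerD2r; apply: (kop_mass_le ker) => x; exact: powR_ge0.
Qed.

Lemma sqr_diff_le_defect g x y w : (forall x, 0 <= g x) ->
  g x <= w -> g y <= w -> K g x <= w ->
  (g x - g y) ^+ 2 <= 2 / (p - 1) ^+ 2 * w `^ (2 - p) * defect g x y.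
Proof.
move=> g0 xw yw mw; have m0 : 0 <= K g x by exact: kop_ge0 ker _ g0 _.
have q0 : 0 < (p - 1) ^+ 2 by rewrite exprn_gt0// subr_gt0.
rewrite -(ler_pM2l q0).
have -> : (p - 1) ^+ 2 * (2 / (p - 1) ^+ 2 * w `^ (2 - p) * defect g x y) =
    2 * (w `^ (2 - p) * defect g x y).
  by move: q0; set q2 := (p - 1) ^+ 2 => q0; field; rewrite gt_eqF.
have h1 := convex_defect (g0 x) m0 xw mw p1 p2.
have h2 := convex_defect (g0 y) m0 yw mw p1 p2.
rewrite /defect /tangent_defect mulrDr.
have : 0 <= (p - 1) ^+ 2 * (g x + g y - 2 * K g x) ^+ 2.
  by rewrite mulr_ge0// ?sqr_ge0// ltW.
move: h1 h2; set q2 := (p - 1) ^+ 2 => h1 h2; nra.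
Qed.

Variables (r C : R).
Hypotheses (r0 : 0 <= r) (C0 : 0 <= C).

(** Stein's argument: at each edge the square function is bounded by a weighted
    geometric mean of the maximal function and of the defects summed over the
    iterates; Hoelder's inequality separates the two. *)
Lemma square_function_ge0 f n : (forall x, 0 <= f x) ->
  \sum_(j < n) r ^+ j * (lp_mass (iter j K f) - lp_mass (iter j.+1 K f))
    <= C * lp_mass f ->
  \sum_x \sum_y nu x * k x y *
    (\sum_(j < n) r ^+ j * (iter j K f x - iter j K f y) ^+ 2) `^ (p / 2) <=
  (2 / (p - 1) ^+ 2) `^ (p / 2) * (4 * Q) `^ (1 - p / 2) * (3 * C) `^ (p / 2)
    * lp_mass f.
Proof.
move=> f0 Hen.
have it0 i x : 0 <= iter i K f x by exact: (iter_kop_ge0 ker).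
have [W [W0 Wmax Wsum]] := maximal_function n f0.
have rj0 j : 0 <= r ^+ j by exact: exprn_ge0.
pose c : R := 2 / (p - 1) ^+ 2; pose t := p / 2.
have c0 : 0 <= c by rewrite divr_ge0// sqr_ge0.
have t0 : 0 < t by rewrite divr_gt0.
have t1 : t <= 1 by rewrite ler_pdivrMr// mul1r.
pose w x y := Num.max (W x) (W y).
have w0 x y : 0 <= w x y by rewrite le_max W0.
pose S x y := \sum_(j < n) r ^+ j * defect (iter j K f) x y.
have S0 x y : 0 <= S x y.
  by apply: sumr_ge0 => j _; rewrite mulr_ge0// defect_ge0.
have E0 : 0 <= lp_mass f by exact: lp_mass_ge0.
have Q0 : 0 <= Q by exact: powR_ge0.
have nk0 x y : 0 <= nu x * k x y by exact: mulr_ge0.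
apply: (@le_trans _ _ (\sum_x \sum_y nu x * k x y *
    (c `^ t * (S x y `^ t * (w x y `^ p) `^ (1 - t))))).
  apply: ler_sum => x _; apply: ler_sum => y _; rewrite ler_wpM2l//.
  have -> : c `^ t * (S x y `^ t * (w x y `^ p) `^ (1 - t)) =
      (c * w x y `^ (2 - p) * S x y) `^ t.
    have cw : 0 <= c * w x y `^ (2 - p) by apply: mulr_ge0 => //; exact: powR_ge0.
    rewrite [RHS]powRM// [X in _ = X * _]powRM ?powR_ge0// -!powRrM.
    have -> : p * (1 - t) = (2 - p) * t by rewrite /t; field.
    by ring.
  apply: le_powR; first exact: ltW.
    by apply: sumr_ge0 => j _; rewrite mulr_ge0// sqr_ge0.
  rewrite mulr_sumr; apply: ler_sum => j _.
  rewrite [leRHS]mulrCA ler_wpM2l//; apply: sqr_diff_le_defect => //.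
  - by rewrite le_max Wmax// ltnW.
  - by rewrite le_max [X in _ || X]Wmax ?orbT// ltnW.
  - by rewrite le_max -[K _]/(iter j.+1 K f) Wmax.
under eq_bigr do under eq_bigr do rewrite mulrCA.
rewrite pair_bigA/= -mulr_sumr -!mulrA ler_wpM2l ?powR_ge0//.
have Ht : 0 <= t <= 1 by rewrite (ltW t0).
have := @hoelder_sum _ _ (index_enum ((T * T)%type : finType))
  (fun z => nu z.1 * k z.1 z.2) (fun z => S z.1 z.2) (fun z => w z.1 z.2 `^ p) t
  (fun z => nk0 _ _) (fun z => S0 _ _) (fun z => powR_ge0 _ _) Ht.
move=> /le_trans; apply.
rewrite -(pair_bigA _ (fun x y => nu x * k x y * S x y)).
rewrite -(pair_bigA _ (fun x y => nu x * k x y * w x y `^ p))/=.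
have HS : \sum_x \sum_y nu x * k x y * S x y <= 3 * C * lp_mass f.
  have -> : \sum_x \sum_y nu x * k x y * S x y = \sum_(j < n) r ^+ j *
     \sum_x \sum_y nu x * k x y * defect (iter j K f) x y.
    under eq_bigr do under eq_bigr do rewrite /S mulr_sumr.
    under eq_bigr do rewrite exchange_big/=.
    rewrite exchange_big/=; apply: eq_bigr => j _.
    rewrite mulr_sumr; apply: eq_bigr => x _; rewrite mulr_sumr.
    by apply: eq_bigr => y _; rewrite mulrCA.
  rewrite -mulrA (le_trans _ (ler_wpM2l _ Hen))// mulr_sumr.
  apply: ler_sum => j _; rewrite [leRHS]mulrCA ler_wpM2l//.
  exact: defect_sum.
have HW : \sum_x \sum_y nu x * k x y * w x y `^ p <= 4 * Q * lp_mass f.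
  have row V : (forall x, 0 <= V x) ->
      \sum_x \sum_y nu x * k x y * V x <= \sum_x nu x * V x.
    move=> V0; apply: ler_sum => x _; rewrite -mulr_suml -mulr_sumr.
    rewrite -mulrA ler_wpM2l// ler_piMl//; exact: kernel_sub ker x.
  have WW := row _ (fun x => powR_ge0 (W x) p).
  have WW' : \sum_x \sum_y nu x * k x y * W y `^ p <= \sum_x nu x * W x `^ p.
    rewrite exchange_big/=; apply: le_trans WW.
    by apply: ler_sum => x _; apply: ler_sum => y _; rewrite (kernel_sym ker).
  apply: (@le_trans _ _ (\sum_x \sum_y nu x * k x y * (W x `^ p + W y `^ p))).
    apply: ler_sum => x _; apply: ler_sum => y _; rewrite ler_wpM2l//.
    exact: powR_maxD.
  under eq_bigr do under eq_bigr do rewrite mulrDr.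
  under eq_bigr do rewrite big_split/=.
  rewrite big_split/=.
  move: WW WW' Wsum; lra.
have sum0 (F : T -> T -> R) : (forall x y, 0 <= F x y) ->
    0 <= \sum_x \sum_y nu x * k x y * F x y.
  by move=> F0; apply: sumr_ge0 => x _; apply: sumr_ge0 => y _; rewrite mulr_ge0.
apply: (@le_trans _ _ ((3 * C * lp_mass f) `^ t * (4 * Q * lp_mass f) `^ (1 - t))).
  apply: ler_pM; rewrite ?powR_ge0//.
    by apply: le_powR => //; [exact: ltW|exact: sum0].
  apply: le_powR => //; first by rewrite subr_ge0.
  by apply: sum0 => x y; exact: powR_ge0.
rewrite (powRM _ _ E0) ?mulr_ge0// (powRM _ _ E0) ?mulr_ge0//.
rewrite le_eqVlt; apply/orP; left; apply/eqP.
by rewrite -[in RHS](powR_split E0 t0) -/t; ring.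
Qed.

(** A signed [f] is split into its positive and negative parts, which costs the
    factor [4 `^ (p / 2)]. *)
Lemma square_function f n :
  (forall g, (forall x, 0 <= g x) ->
    \sum_(j < n) r ^+ j * (lp_mass (iter j K g) - lp_mass (iter j.+1 K g))
      <= C * lp_mass g) ->
  \sum_x \sum_y nu x * k x y *
    (\sum_(j < n) r ^+ j * (iter j K f x - iter j K f y) ^+ 2) `^ (p / 2) <=
  4 `^ (p / 2) * ((2 / (p - 1) ^+ 2) `^ (p / 2) * (4 * Q) `^ (1 - p / 2)
    * (3 * C) `^ (p / 2)) * lp_mass f.
Proof.
move=> Hen.
pose fp x := Num.max (f x) 0; pose fn x := Num.max (- f x) 0.
have fp0 x : 0 <= fp x by rewrite le_max lexx orbT.
have fn0 x : 0 <= fn x by rewrite le_max lexx orbT.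
have fE x : f x = fp x + - 1 * fn x.
  by rewrite /fp /fn; case: (leP (f x) 0); case: (leP (- f x) 0); lra.
have itE j x : iter j K f x = iter j K fp x - iter j K fn x.
  elim: j x => [|j IH] x; first by rewrite /= fE mulN1r.
  rewrite /= -mulN1r -kopZ -kopD; apply: eq_kop => y.
  by rewrite IH mulN1r.
have rj0 j : 0 <= r ^+ j by exact: exprn_ge0.
have t0 : 0 <= p / 2 by rewrite divr_ge0// ltW.
have S0 g x y : 0 <= \sum_(j < n) r ^+ j * (iter j K g x - iter j K g y) ^+ 2.
  by apply: sumr_ge0 => j _; rewrite mulr_ge0// sqr_ge0.
set c := _ * (3 * C) `^ (p / 2).
have H g (g0 : forall x, 0 <= g x) := square_function_ge0 g0 (Hen _ g0).
have mE : lp_mass f = lp_mass fp + lp_mass fn.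
  rewrite /lp_mass -big_split/=; apply: eq_bigr => x _.
  rewrite -mulrDr; congr (_ * _); rewrite /fp /fn.
  have [h|h] : 0 <= f x \/ f x <= 0 by apply/orP; exact: le_total.
    by rewrite max_l// (max_r (x := - f x)) ?oppr_le0// normr0 powR0 ?gt_eqF// addr0.
  by rewrite max_r// max_l ?oppr_ge0// normr0 powR0 ?gt_eqF// add0r normrN.
rewrite mE -mulrA mulrDr.
apply: le_trans (ler_wpM2l (powR_ge0 _ _) (lerD (H _ fp0) (H _ fn0))).
rewrite -big_split/= mulr_sumr; apply: ler_sum => x _.
rewrite -big_split/= mulr_sumr; apply: ler_sum => y _.
rewrite -mulrDr mulrCA ler_wpM2l ?mulr_ge0//.
apply: le_trans (powR_addD (S0 _ _ _) (S0 _ _ _) t0).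
apply: le_powR => //.
rewrite !mulr_sumr -big_split/=; apply: ler_sum => j _.
rewrite !itE; have := rj0 j; move: (r ^+ j) => rj hrj.
have := sqr_ge0 (iter j K fp x - iter j K fp y + (iter j K fn x - iter j K fn y)).
move=> /(mulr_ge0 hrj); lra.
Qed.

(** Interpolation between contraction on [l^1] and the bound [d] on [l^2].  For a
    positive kernel this is Hoelder's inequality, once on each row, for the
    factorization of [g] into powers of [g `^ p] and [g `^ (p / 2)], and once
    for the sum over the vertices. *)
Lemma lp_mass_gap d g : 0 <= d ->
  (forall h, \sum_x nu x * K h x ^+ 2 <= d * \sum_x nu x * h x ^+ 2) ->
  (forall x, 0 <= g x) -> lp_mass (K g) <= d `^ (p - 1) * lp_mass g.
Proof.
move=> d0 gap g0; have Kg0 : forall x, 0 <= K g x by exact: kop_ge0 ker _ g0.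
rewrite !lp_massE//.
pose h y := g y `^ (p / 2).
have h0 y : 0 <= h y by exact: powR_ge0.
have gp0 y : 0 <= g y `^ p by exact: powR_ge0.
pose A := K (fun y => g y `^ p).
have A0 x : 0 <= A x by exact: kop_ge0 ker _ gp0 _.
have Kh0 x : 0 <= K h x by exact: kop_ge0 ker _ h0 _.
have q0 : 0 < p - 1 by rewrite subr_gt0.
have E0 : 0 <= \sum_x nu x * g x `^ p.
  by apply: sumr_ge0 => x _; rewrite mulr_ge0.
pose a := (2 - p) / p.
have a01 : 0 <= a <= 1.
  rewrite /a divr_ge0 ?subr_ge0 ?(ltW p0)//= ler_pdivrMr// mul1r.
  by move: p1; lra.
have e1 : p * a = 1 - (p - 1) by rewrite /a; field; rewrite gt_eqF.
have e2 : p / 2 * (1 - a) = p - 1 by rewrite /a; field; rewrite gt_eqF.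
have e3 : (1 - a) * p = 2 * (p - 1) by rewrite /a; field; rewrite gt_eqF.
have pointwise x : K g x `^ p <= A x `^ (1 - (p - 1)) * (K h x ^+ 2) `^ (p - 1).
  have := @hoelder_sum _ _ (index_enum T) (k x) (fun y => g y `^ p) h a
    (k0 x) gp0 h0 a01.
  rewrite -/(kop k h x) -/(kop k (fun y => g y `^ p) x) -/K -/(A x).
  have -> : \sum_i k x i * ((g i `^ p) `^ a * h i `^ (1 - a)) = K g x.
    apply: eq_bigr => y _; congr (_ * _).
    by rewrite /h -!powRrM e1 e2 powR_split.
  move=> H; apply: le_trans (le_powR (ltW p0) (Kg0 x) H) _.
  rewrite powRM ?powR_ge0// -!powRrM -powR_mulrn// -powRrM e3.
  by rewrite [a * p]mulrC e1.
apply: (@le_trans _ _ (\sum_x nu x * (A x `^ (1 - (p - 1)) *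
    (K h x ^+ 2) `^ (1 - (1 - (p - 1)))))).
  by apply: ler_sum => x _; rewrite ler_wpM2l// subKr.
have t01 : 0 <= 1 - (p - 1) <= 1 by move: p1 p2; lra.
have := @hoelder_sum _ _ (index_enum T) nu A (fun x => K h x ^+ 2) _
  nu0 A0 (fun x => sqr_ge0 _) t01.
move=> /le_trans; apply; rewrite subKr.
rewrite -[X in _ <= _ * X](powR_split E0 q0) [leRHS]mulrCA.
have h2 : \sum_x nu x * h x ^+ 2 = \sum_x nu x * g x `^ p.
  by apply: eq_bigr => x _; rewrite /h -powR_mulrn ?powR_ge0// -powRrM divfK.
rewrite -powRM// -h2; apply: ler_pM; rewrite ?powR_ge0//.
  apply: le_powR; [by move: p2; lra| |].
    by apply: sumr_ge0 => x _; rewrite mulr_ge0.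
  by rewrite h2; exact: (kop_mass_le ker).
apply: le_powR => //; first exact: ltW.
by apply: sumr_ge0 => x _; rewrite mulr_ge0// sqr_ge0.
Qed.

End SquareFunction.

(** * Energy dissipation along the iterates *)

Section EnergyDissipation.
Context {R : realType} {T : finType} (nu : T -> R) (k : T -> T -> R).
Hypothesis ker : symmetric_kernel nu k.
Variables (p : R).
Hypotheses (p1 : 1 < p) (p2 : p <= 2).

(** The loss of [l^p] mass along the iterates, weighted geometrically.  For
    [r = 1] the sum telescopes; for [r > 1] a bound comes from geometric decay of
    the mass. *)
Definition dissipation_bound (r C : R) := forall n g, (forall x, 0 <= g x) ->
  \sum_(j < n) r ^+ j * (lp_mass nu p (iter j (kop k) g)
                         - lp_mass nu p (iter j.+1 (kop k) g)) <= C * lp_mass nu p g.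

Lemma dissipation_bound1 : dissipation_bound 1 1.
Proof.
move=> n g g0; rewrite mul1r.
apply: (@le_trans _ _ (lp_mass nu p g - lp_mass nu p (iter n (kop k) g))).
  elim: n => [|n IH]; first by rewrite big_ord0 subrr.
  by rewrite big_ord_recr/= expr1n; lra.
by rewrite gerBl (lp_mass_ge0 ker).
Qed.

Lemma dissipation_bound_gap r q : 0 <= r -> r * q < 1 ->
  (forall g, (forall x, 0 <= g x) -> lp_mass nu p (kop k g) <= q * lp_mass nu p g) ->
  dissipation_bound r (1 - r * q)^-1.
Proof.
move=> r0 rq gap; set C := _^-1.
have d0 : 0 < 1 - r * q by rewrite subr_gt0.
have C0 : 0 <= C by rewrite invr_ge0 ltW.
elim=> [|n IH] g g0; first by rewrite big_ord0 mulr_ge0// (lp_mass_ge0 ker).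
have Kg0 := kop_ge0 ker g0.
rewrite big_ord_recl/= expr0 mul1r.
rewrite (eq_bigr (fun j : 'I_n => r * (r ^+ j *
   (lp_mass nu p (iter j (kop k) (kop k g))
    - lp_mass nu p (iter j.+1 (kop k) (kop k g)))))); last first.
  by move=> j _; rewrite -!iterSr exprS mulrA.
rewrite -mulr_sumr.
have h1 := ler_wpM2l r0 (IH _ Kg0).
have h2 := ler_wpM2l (mulr_ge0 r0 C0) (gap _ g0).
have h3 : lp_mass nu p g = C * lp_mass nu p g - r * C * (q * lp_mass nu p g).
  have : C * (1 - r * q) = 1 by rewrite mulVf// gt_eqF.
  by move=> e; rewrite -[LHS]mul1r -e; ring.
have h4 := lp_mass_ge0 ker p (kop k g).
by rewrite -mulrA in h2; lra.
Qed.

End EnergyDissipation.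

(** * Dirichlet restrictions of the Laplacian to finite sets *)

(** The operator inequality [A^2 <= K A] for [0 <= A <= K], obtained by
    expanding the nonnegative form of [A] at [g - K^-1 A g]. *)
Lemma sqr_form_le (R : realType) (T : finType) (nu : T -> R)
    (A : (T -> R) -> T -> R) (K : R) (g : T -> R) :
  0 < K ->
  (forall f h s x, A (fun y => f y - s * h y) x = A f x - s * A h x) ->
  (forall f h, \sum_x nu x * (f x * A h x) = \sum_x nu x * (A f x * h x)) ->
  (forall f, 0 <= \sum_x nu x * (f x * A f x)) ->
  (forall f, \sum_x nu x * (f x * A f x) <= K * \sum_x nu x * f x ^+ 2) ->
  \sum_x nu x * A g x ^+ 2 <= K * \sum_x nu x * (g x * A g x).
Proof.
move=> K0 lin sym pos bnd; set n := \sum_x nu x * A g x ^+ 2.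
set q := \sum_x nu x * (g x * A g x).
have := pos (fun y => g y - K^-1 * A g y).
rewrite (eq_bigr (fun x => nu x * (g x * A g x) - K^-1 * (nu x * A g x ^+ 2)
   - K^-1 * (nu x * (g x * A (A g) x)) + K^-1 ^+ 2 * (nu x * (A g x * A (A g) x))));
  last by move=> x _; rewrite lin; ring.
rewrite big_split/= !sumrB -!mulr_sumr sym -/q.
have -> : \sum_x nu x * (A g x * A g x) = n.
  by apply: eq_bigr => x _; rewrite expr2.
rewrite -/n => h.
have h2 := ler_wpM2l (sqr_ge0 K^-1) (bnd (A g)).
rewrite -/n in h2.
have e : K^-1 ^+ 2 * (K * n) = K^-1 * n by field; rewrite gt_eqF.
have : 0 <= q - K^-1 * n by move: h h2; rewrite e; lra.
by move/(mulr_ge0 (ltW K0)); rewrite mulrBr mulVKf ?gt_eqF// subr_ge0.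
Qed.

Section FiniteLaplacian.
Context {R : realType} {T : finType} (nu : T -> R) (m : T -> T -> R) (c : T -> R).
Variable M : R.
Hypotheses (nu_gt0 : forall x, 0 < nu x) (m_ge0 : forall x y, 0 <= m x y)
  (m_sym : forall x y, m x y = m y x) (m_sub : forall x, \sum_y m x y <= c x)
  (c_le : forall x, c x <= M * nu x).
Implicit Types g h : T -> R.

(** Dirichlet boundary conditions: [c x] stands for the degree of [x] in the
    whole graph, which may exceed the sum of [m x] over the finite set. *)
Definition dirichlet_lap g x : R :=
  (nu x)^-1 * (c x * g x - \sum_y m x y * g y).

Let L := dirichlet_lap.

Lemma nu_dirichlet_lap g x : nu x * L g x = c x * g x - \sum_y m x y * g y.
Proof. by rewrite mulVKf// gt_eqF. Qed.

Lemma dirichlet_lapB g h s x : L (fun y => g y - s * h y) x = L g x - s * L h x.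
Proof.
rewrite /L /dirichlet_lap mulrCA -mulrBr; congr (_ * _).
have -> : \sum_y m x y * (g y - s * h y) =
    \sum_y m x y * g y - s * \sum_y m x y * h y.
  by rewrite mulr_sumr -sumrB; apply: eq_bigr => y _; ring.
by ring.
Qed.

Lemma dirichlet_lap_form g h : \sum_x nu x * (g x * L h x) =
  \sum_x c x * g x * h x - \sum_x \sum_y m x y * (g x * h y).
Proof.
rewrite -sumrB; apply: eq_bigr => x _.
rewrite mulrCA nu_dirichlet_lap mulrBr mulr_sumr; congr (_ - _); first ring.
by apply: eq_bigr => y _; ring.
Qed.

Lemma dirichlet_lap_sym g h :
  \sum_x nu x * (g x * L h x) = \sum_x nu x * (L g x * h x).
Proof.
rewrite [RHS](eq_bigr (fun x => nu x * (h x * L g x))); last first.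
  by move=> x _; rewrite [L g x * _]mulrC.
rewrite !dirichlet_lap_form; congr (_ - _).
  by apply: eq_bigr => x _; ring.
rewrite exchange_big/=; apply: eq_bigr => x _; apply: eq_bigr => y _.
by rewrite m_sym; ring.
Qed.

Let sqr_sum_le g : \sum_x \sum_y m x y * g x ^+ 2 <= \sum_x c x * g x * g x.
Proof.
apply: ler_sum => x _; rewrite -mulr_suml -mulrA -expr2 ler_wpM2r// sqr_ge0//.
Qed.

Let cross_le g s : s ^+ 2 = 1 ->
  - (s * \sum_x \sum_y m x y * (g x * g y)) <= \sum_x \sum_y m x y * g x ^+ 2.
Proof.
move=> s2.
have e : \sum_x \sum_y m x y * g x ^+ 2 =
    \sum_x \sum_y m x y * ((g x ^+ 2 + g y ^+ 2) / 2).
  have -> : \sum_x \sum_y m x y * ((g x ^+ 2 + g y ^+ 2) / 2) =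
      (\sum_x \sum_y m x y * g x ^+ 2 + \sum_x \sum_y m x y * g y ^+ 2) / 2.
    rewrite -big_split/= mulr_suml; apply: eq_bigr => x _.
    rewrite -big_split/= mulr_suml; apply: eq_bigr => y _; lra.
  have -> : \sum_x \sum_y m x y * g y ^+ 2 = \sum_x \sum_y m x y * g x ^+ 2.
    by rewrite exchange_big/=; do 2 (apply: eq_bigr => ? _); rewrite m_sym.
  lra.
rewrite e mulr_sumr -sumrN; apply: ler_sum => x _.
rewrite mulr_sumr -sumrN; apply: ler_sum => y _.
have : 0 <= m x y * ((s * g x + g y) ^+ 2 / 2) by rewrite mulr_ge0 ?divr_ge0 ?sqr_ge0.
rewrite (_ : (s * g x + g y) ^+ 2 = g x ^+ 2 + g y ^+ 2 + 2 * s * (g x * g y)).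
  lra.
by rewrite sqrrD exprMn s2; ring.
Qed.

Lemma dirichlet_lap_ge0 g : 0 <= \sum_x nu x * (g x * L g x).
Proof.
rewrite dirichlet_lap_form.
have := sqr_sum_le g; have := @cross_le g (-1); rewrite sqrrN expr1n => /(_ erefl).
lra.
Qed.

Lemma dirichlet_lap_le g :
  \sum_x nu x * (g x * L g x) <= 2 * M * \sum_x nu x * g x ^+ 2.
Proof.
rewrite dirichlet_lap_form.
have := sqr_sum_le g; have := @cross_le g 1; rewrite expr1n => /(_ erefl).
have : \sum_x c x * g x * g x <= M * \sum_x nu x * g x ^+ 2.
  rewrite mulr_sumr; apply: ler_sum => x _.
  by rewrite -mulrA -expr2 mulrA ler_wpM2r ?sqr_ge0.
lra.
Qed.

Variable tau : R.
Hypotheses (tau_gt0 : 0 < tau) (M_gt0 : 0 < M) (tauM : tau * M <= 2^-1).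

(** The matrix of [1 - tau L]; it is lazy as [tau M <= 1/2]. *)
Definition lazy_walk x y : R :=
  (x == y)%:R * (1 - tau * (c x / nu x)) + tau * (m x y / nu x).

Let lazy_stay x : 2^-1 <= 1 - tau * (c x / nu x).
Proof.
have : tau * (c x / nu x) <= tau * M by rewrite ler_pM2l// ler_pdivrMr.
by move: tauM; lra.
Qed.

Lemma lazy_walk_symmetric_kernel : symmetric_kernel nu lazy_walk.
Proof.
split=> [x|x y|x y|x].
- exact: ltW.
- rewrite addr_ge0// mulr_ge0//; [|exact: ltW|by rewrite divr_ge0// ltW].
  exact: le_trans (lazy_stay x).
- rewrite /lazy_walk; have [->//|ne] := eqVneq x y.
  by rewrite !mul0r !add0r m_sym; field; rewrite !gt_eqF.
- rewrite /lazy_walk big_split/= -mulr_sumr -mulr_suml -mulr_suml.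
  rewrite (bigD1 x)//= eqxx big1 ?addr0; last first.
    by move=> y; rewrite eq_sym => /negbTE->.
  have : (\sum_y m x y) / nu x <= c x / nu x.
    by rewrite ler_wpM2r// invr_ge0 ltW.
  move/(ler_wpM2l (ltW tau_gt0)); rewrite mulr1n; lra.
Qed.

Lemma lazy_walk_lazy x : 2^-1 <= lazy_walk x x.
Proof.
rewrite /lazy_walk eqxx mul1r (le_trans (lazy_stay x))// lerDl mulr_ge0//.
  exact: ltW.
by rewrite divr_ge0// ltW.
Qed.

Lemma le_lazy_walk x y : tau * m x y <= nu x * lazy_walk x y.
Proof.
rewrite /lazy_walk mulrDr.
have -> : nu x * (tau * (m x y / nu x)) = tau * m x y by field; rewrite gt_eqF.
rewrite lerDr mulr_ge0 ?(ltW (nu_gt0 x))// mulr_ge0//.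
exact: le_trans (lazy_stay x).
Qed.

Lemma kop_lazy_walk g x : kop lazy_walk g x = g x - tau * L g x.
Proof.
rewrite /kop /lazy_walk.
under eq_bigr do rewrite mulrDl.
rewrite big_split/= (bigD1 x)//= eqxx big1 ?addr0; last first.
  by move=> y; rewrite eq_sym => /negbTE->; rewrite !mul0r.
rewrite mul1r /L /dirichlet_lap.
have -> : \sum_y tau * (m x y / nu x) * g y = tau * (nu x)^-1 * \sum_y m x y * g y.
  by rewrite mulr_sumr; apply: eq_bigr => y _; ring.
by ring.
Qed.

Lemma lazy_walk_gap lam g : 0 <= lam ->
  (forall h, lam * \sum_x nu x * h x ^+ 2 <= \sum_x nu x * (h x * L h x)) ->
  \sum_x nu x * kop lazy_walk g x ^+ 2 <=
  (1 - 2 * lam * tau * (1 - tau * M)) * \sum_x nu x * g x ^+ 2.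
Proof.
move=> lam0 gap.
rewrite (eq_bigr (fun x => nu x * g x ^+ 2 - 2 * tau * (nu x * (g x * L g x))
   + tau ^+ 2 * (nu x * L g x ^+ 2))); last first.
  by move=> x _; rewrite kop_lazy_walk; ring.
rewrite big_split/= sumrB -!mulr_sumr.
have M20 : 0 < 2 * M by rewrite mulr_gt0.
have := @sqr_form_le _ _ nu L (2 * M) g M20 dirichlet_lapB dirichlet_lap_sym
  dirichlet_lap_ge0 dirichlet_lap_le.
set n := \sum_x nu x * L g x ^+ 2; set q := \sum_x nu x * (g x * L g x).
set s := \sum_x nu x * g x ^+ 2 => h.
have h1 := ler_wpM2l (sqr_ge0 tau) h.
have u0 : 0 <= 2 * tau * (1 - tau * M).
  by rewrite mulr_ge0 ?mulr_ge0 ?(ltW tau_gt0)//; move: tauM; lra.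
have h2 := ler_wpM2l u0 (gap g).
rewrite -/s -/q in h2; lra.
Qed.

End FiniteLaplacian.

Section Restriction.
Context {R : realType} {V : choiceType} (G : weighted_graph R V).
Implicit Types (f g : V -> R) (B : {fset V}) (x y : V).

Definition supported_in B f := forall x, x \notin B -> f x = 0.

Lemma supported_inS B1 B2 f : (B1 `<=` B2)%fset ->
  supported_in B1 f -> supported_in B2 f.
Proof. by move=> /fsubsetP s h x /(contra (s x))/h. Qed.

Lemma finitely_supportedP f : finitely_supported f <-> exists B, supported_in B f.
Proof.
split=> [fin|[B h]].
  exists (fset_set [set x | f x != 0]) => x; rewrite in_fset_set// notin_setE/=.
  by move/negP; rewrite negbK => /eqP.
apply: (sub_finite_set _ (finite_fset B)) => x /=; apply: contra_neqT => /h//.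
Qed.

Lemma fsum_fset B (h : V -> R) : supported_in B h ->
  \sum_(x \in [set: V]) h x = \sum_(x : B) h (val x).
Proof. by move=> sB; rewrite (fsbigTE B)// big_seq_fsetE. Qed.

Lemma muC x y : mu G x y = mu G y x.
Proof. by rewrite /mu /adj setUC. Qed.

Lemma mu_ge0 x y : 0 <= mu G x y.
Proof.
rewrite /mu; case: ifPn => // axy; apply/ltW/edge_weight_gt0.
by move: axy; rewrite /adj inE.
Qed.

Definition neighbors x : {fset V} := fset_set [set y | adj G x y].

Lemma supported_mu x : supported_in (neighbors x) (mu G x).
Proof.
move=> y; rewrite in_fset_set; last exact: locally_finite.
by rewrite notin_setE /= /mu => /negP/negbTE->.
Qed.

Lemma sum_mu_le_deg B x : \sum_(y : B) mu G x (val y) <= deg G x.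
Proof.
rewrite -(big_seq_fsetE _ _ xpredT (mu G x))/= /deg.
rewrite (fsbigTE (B `|` neighbors x)%fset); last first.
  by apply: supported_inS (@supported_mu x); exact: fsubsetUr.
rewrite [leRHS](big_fsetID _ (mem B))/=.
rewrite (_ : [fset y in _ | _]%fset = B); last first.
  apply/fsetP => y; rewrite !inE/= andb_orl andbb.
  by case: (y \in B) => //=; rewrite andbF.
by rewrite lerDl; apply: sumr_ge0 => y _; exact: mu_ge0.
Qed.

Lemma laplacian_restrict B f x : supported_in B f ->
  laplacian G f x =
  (vertex_weight G x)^-1 * (deg G x * f x - \sum_(y : B) mu G x (val y) * f (val y)).
Proof.
move=> sf; rewrite /laplacian; congr (_ * _).
have sx : supported_in (neighbors x) (fun y => mu G x y * (f x - f y)).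
  by move=> y /supported_mu->; rewrite mul0r.
rewrite (fsbigTE (neighbors x))// /deg (fsbigTE (neighbors x)); last first.
  exact: supported_mu.
have <- : \sum_(y \in [set: V]) mu G x y * f y = \sum_(y : B) mu G x (val y) * f (val y).
  by apply: fsum_fset => y /sf->; rewrite mulr0.
rewrite (fsbigTE (neighbors x)); last by move=> y /supported_mu->; rewrite mul0r.
by rewrite mulr_suml -sumrB; apply: eq_bigr => y _; rewrite mulrBr.
Qed.

Lemma laplacian_finite f : finitely_supported f ->
  finitely_supported (laplacian G f).
Proof.
move=> /finitely_supportedP[B sB]; apply/finitely_supportedP.
exists (B `|` \big[fsetU/fset0]_(y : B) neighbors (val y))%fset => x.
rewrite inE negb_or => /andP[xB xN].
rewrite (laplacian_restrict _ sB) sB// mulr0 sub0r big1 ?oppr0 ?mulr0// => y _.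
rewrite muC supported_mu ?mul0r//; apply: contra xN => xN.
by apply/bigfcupP; exists y => //; rewrite mem_index_enum.
Qed.

Definition walk (tau : R) f x : R := f x - tau * laplacian G f x.

Lemma walk_finite tau f : finitely_supported f -> finitely_supported (walk tau f).
Proof.
move=> fin; have := laplacian_finite fin.
move/finitely_supportedP : fin => [B sB] /finitely_supportedP[B' sB'].
apply/finitely_supportedP; exists (B `|` B')%fset => x.
by rewrite inE negb_or => /andP[/sB + /sB']; rewrite /walk => -> ->; rewrite mulr0 subr0.
Qed.

Lemma iter_walk_finite tau f n : finitely_supported f ->
  finitely_supported (iter n (walk tau) f).
Proof. by move=> fin; elim: n => //= n; exact: walk_finite. Qed.

(** The walk moves along one edge at a time, so finitely many iterates live in
    one finite set, where they are the iterates of the restricted kernel. *)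
Lemma iter_walk_supported tau f n B0 : finitely_supported f ->
  exists2 B, (B0 `<=` B)%fset &
    forall j, (j <= n)%N -> supported_in B (iter j (walk tau) f).
Proof.
move=> fin; elim: n => [|n [B BB sB]].
  have [B sB] := (finitely_supportedP f).1 fin.
  exists (B0 `|` B)%fset; first exact: fsubsetUl.
  by move=> j; rewrite leqn0 => /eqP->; apply: supported_inS sB; exact: fsubsetUr.
have [B' sB'] := (finitely_supportedP _).1 (iter_walk_finite tau n.+1 fin).
exists (B `|` B')%fset; first exact: fsubset_trans BB (fsubsetUl _ _).
move=> j; rewrite leq_eqVlt => /orP[/eqP->|/sB].
  by apply: supported_inS sB'; exact: fsubsetUr.
by apply: supported_inS; exact: fsubsetUl.
Qed.

Section Fixed.
Variable B : {fset V}.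
Let nuB (x : B) := vertex_weight G (val x).
Let muB (x y : B) := mu G (val x) (val y).
Let degB (x : B) := deg G (val x).

Lemma laplacian_dirichlet f (x : B) : supported_in B f ->
  laplacian G f (val x) = dirichlet_lap nuB muB degB (f \o val) x.
Proof. by move=> sf; rewrite (laplacian_restrict _ sf). Qed.

Lemma iter_walk_dirichlet tau f n (x : B) :
  (forall j, (j < n)%N -> supported_in B (iter j (walk tau) f)) ->
  iter n (walk tau) f (val x) =
  iter n (kop (lazy_walk nuB muB degB tau)) (f \o val) x.
Proof.
elim: n x => //= n IH x sB.
have IH' (y : B) := IH y (fun j jn => sB j (ltnW jn)).
rewrite {1}/walk (laplacian_dirichlet _ (sB n _))// IH'.
have -> : iter n (walk tau) f \o val =
    iter n (kop (lazy_walk nuB muB degB tau)) (f \o val).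
  by apply/funext => y; exact: IH'.
by rewrite kop_lazy_walk// => y; exact: vertex_weight_gt0.
Qed.

Definition extend (g : B -> R) x : R := if insub x is Some y then g y else 0.

Lemma extend_val (g : B -> R) (x : B) : extend g (val x) = g x.
Proof. by rewrite /extend valK. Qed.

Lemma extend_supported (g : B -> R) : supported_in B (extend g).
Proof. by move=> x /negbTE xB; rewrite /extend insubF. Qed.

End Fixed.

End Restriction.

(** * The spectral gap as a lower bound of the quadratic form *)

Section SpectralGap.
Context {R : realType} {V : choiceType} (G : weighted_graph R V).
Implicit Types (f g : V -> R) (B : {fset V}).

Lemma lpV_norm_fset B (p : R) f : 0 < p -> supported_in B f ->
  lpV_norm G p f =
  ((\sum_(x : B) vertex_weight G (val x) * `|f (val x)| `^ p) `^ p^-1)%:E.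
Proof.
move=> p0 sB; rewrite /lpV_norm /lp_norm -poweR_EFin; congr (_ `^ _)%E.
transitivity (\esum_(x in [set` B]) (vertex_weight G x * `|f x| `^ p)%:E).
  rewrite [RHS]esum_mkcond; apply: eq_esum => x _; rewrite mem_setE/=.
  case: ifPn => [_|/sB fx0]; first by [].
  by rewrite fx0 normr0 powR0 ?gt_eqF// mule0.
rewrite (@esum_fset R V [set` B]); [|exact: finite_fset|]; last first.
  by move=> x _; rewrite lee_fin mulr_ge0 ?powR_ge0// ltW// vertex_weight_gt0.
by rewrite -fsbig_seq// sumEFin big_seq_fsetE.
Qed.

Variable M : R.
Hypotheses (M0 : 0 < M) (degM : forall x, deg G x <= M * vertex_weight G x).

Let nuB B (x : B) := vertex_weight G (val x).
Let lapB B (g : B -> R) :=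
  dirichlet_lap (@nuB B) (fun x y => mu G (val x) (val y)) (fun x => deg G (val x)) g.
Let sq B (g : B -> R) := \sum_(x : B) nuB x * g x ^+ 2.
Let form B (g : B -> R) := \sum_(x : B) nuB x * (g x * lapB g x).

Let lower_bound l := forall B (g : B -> R), l * sq g <= form g.

Let nuB_gt0 B (x : B) : 0 < nuB x.
Proof. exact: vertex_weight_gt0. Qed.

Let sq_ge0 B (g : B -> R) : 0 <= sq g.
Proof. by apply: sumr_ge0 => x _; rewrite mulr_ge0 ?sqr_ge0// ltW. Qed.

Let lower_bound0 : lower_bound 0.
Proof.
move=> B g; rewrite mul0r; apply: dirichlet_lap_ge0 => //.
- by move=> x y; exact: mu_ge0.
- by move=> x y; exact: muC.
- by move=> x; exact: sum_mu_le_deg.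
Qed.

Let form_le B (g : B -> R) : form g <= 2 * M * sq g.
Proof.
apply: (@dirichlet_lap_le _ _ _ _ _ M) => //.
- by move=> x y; exact: mu_ge0.
- by move=> x y; exact: muC.
- by move=> x; exact: sum_mu_le_deg.
Qed.

(** A bounded inverse of [Delta - l] bounds [f] by [(Delta - l) f] in norm,
    hence by the form of [Delta - l] when this form is nonnegative: the form
    lower bound [l] is not optimal. *)
Lemma resolvent_not_bottom (l : R) : 0 <= l -> lower_bound l -> resolvent_set G l ->
  exists2 e, 0 < e & lower_bound (l + e).
Proof.
move=> l0 lb [S [C HS]].
pose D := C ^+ 2 * (2 * M) + 1.
have D0 : 0 < D by rewrite ltr_wpDl// mulr_ge0 ?sqr_ge0// mulr_ge0// ltW.
exists D^-1; first by rewrite invr_gt0.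
move=> B g; pose f := extend g.
have sf : supported_in B f by exact: extend_supported.
have [B' [BB' sh]] : exists B', (B `<=` B')%fset /\ supported_in B' (laplacian G f).
  have fin : finitely_supported f by apply/finitely_supportedP; exists B.
  have [B1 s1] := (finitely_supportedP _).1 (laplacian_finite G fin).
  exists (B `|` B1)%fset; split; first exact: fsubsetUl.
  by apply: supported_inS s1; exact: fsubsetUr.
have sf' : supported_in B' f by exact: supported_inS sf.
pose f' (x : B') := f (val x).
have sqE : sq g = sq f'.
  transitivity (\sum_(x \in [set: V]) vertex_weight G x * f x ^+ 2).
    rewrite (@fsum_fset _ _ B); last by move=> x /sf->; rewrite expr0n mulr0.
    by apply: eq_bigr => x _; rewrite /f extend_val.
  by rewrite (@fsum_fset _ _ B')// => x /sf'->; rewrite expr0n mulr0.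
have formE : form g = form f'.
  transitivity (\sum_(x \in [set: V]) vertex_weight G x * (f x * laplacian G f x)).
    rewrite (@fsum_fset _ _ B); last by move=> x /sf->; rewrite mul0r mulr0.
    apply: eq_bigr => x _; rewrite (laplacian_dirichlet _ _ sf).
    rewrite /f extend_val; congr (_ * (_ * _)); congr (dirichlet_lap _ _ _ _ _).
    by apply/funext => y /=; rewrite extend_val.
  rewrite (@fsum_fset _ _ B'); last by move=> x /sf'->; rewrite mul0r mulr0.
  by apply: eq_bigr => x _; rewrite (laplacian_dirichlet _ _ sf').
rewrite sqE formE.
pose A (h : B' -> R) x := lapB h x - l * h x.
have posA h : 0 <= \sum_x nuB x * (h x * A h x).
  rewrite (eq_bigr (fun x => nuB x * (h x * lapB h x) - l * (nuB x * h x ^+ 2)));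
    last by move=> x _; rewrite /A; ring.
  by rewrite sumrB -mulr_sumr subr_ge0; exact: lb.
have formA h : \sum_x nuB x * (h x * A h x) = form h - l * sq h.
  rewrite (eq_bigr (fun x => nuB x * (h x * lapB h x) - l * (nuB x * h x ^+ 2)));
    last by move=> x _; rewrite /A; ring.
  by rewrite sumrB -mulr_sumr.
have key : \sum_x nuB x * A f' x ^+ 2 <= 2 * M * (form f' - l * sq f').
  rewrite -formA; apply: sqr_form_le => //.
  - by rewrite mulr_gt0.
  - by move=> u v s x; rewrite /A /lapB dirichlet_lapB; ring.
  - move=> u v.
    have := @dirichlet_lap_sym _ _ (@nuB B') (fun x y => mu G (val x) (val y))
      (fun x => deg G (val x)) (@nuB_gt0 B') (fun x y => muC G _ _) u v => e.
    rewrite (eq_bigr (fun x => nuB x * (u x * lapB v x) - l * (nuB x * (u x * v x))));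
      last by move=> x _; rewrite /A; ring.
    rewrite [RHS](eq_bigr (fun x => nuB x * (lapB u x * v x) - l * (nuB x * (u x * v x))));
      last by move=> x _; rewrite /A; ring.
    by rewrite !sumrB e.
  - move=> h; rewrite formA.
    by have := form_le h; have := mulr_ge0 l0 (sq_ge0 h); rewrite -/(sq h); lra.
have sA : supported_in B' (fun x => laplacian G f x - l * f x).
  by move=> x xB; rewrite sh// sf'// mulr0 subr0.
have normE u : supported_in B' u -> lpV_norm G 2 u =
    (Num.sqrt (\sum_(x : B') nuB x * u (val x) ^+ 2))%:E.
  move=> su; rewrite (lpV_norm_fset _ su)// powR12_sqrt; last first.
    by apply: sumr_ge0 => x _; rewrite mulr_ge0 ?powR_ge0// ltW// vertex_weight_gt0.
  congr (Num.sqrt _)%:E; apply: eq_bigr => x _.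
  by rewrite powR_mulrn// real_normK// num_real.
have l2 u : supported_in B' u -> l2V G u by move=> su; rewrite /l2V normE// ltry.
have [H1 _ _] := HS _ (l2 _ sA).
have [_ H2 _] := HS _ (l2 _ sf').
rewrite H2 !normE// -EFinM lee_fin in H1.
have AE : \sum_(x : B') nuB x * (laplacian G f (val x) - l * f (val x)) ^+ 2 =
    \sum_(x : B') nuB x * A f' x ^+ 2.
  by apply: eq_bigr => x _; rewrite (laplacian_dirichlet _ _ sf').
rewrite AE in H1.
have main : sq f' <= C ^+ 2 * \sum_(x : B') nuB x * A f' x ^+ 2.
  have n0 : 0 <= \sum_(x : B') nuB x * A f' x ^+ 2.
    by apply: sumr_ge0 => x _; rewrite mulr_ge0 ?sqr_ge0// ltW.
  rewrite -(sqr_sqrtr n0) -exprMn -(sqr_sqrtr (sq_ge0 f')).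
  rewrite ler_sqr ?nnegrE ?sqrtr_ge0//.
  exact: le_trans (sqrtr_ge0 _) H1.
have m2 := ler_wpM2l (sqr_ge0 C) key.
have fl : 0 <= form f' - l * sq f' by rewrite subr_ge0; exact: lb.
have : sq f' <= D * (form f' - l * sq f') by rewrite /D; lra.
by move=> h; rewrite mulrDl -lerBrDl ler_pdivrMl.
Qed.

(** The best lower bound of the form is not in the resolvent set, by
    [resolvent_not_bottom], so it cannot be below the spectrum. *)
Lemma spectral_gap_form B (g : B -> R) : 0 < lambda1 G ->
  lambda1 G * sq g <= form g.
Proof.
move=> lam0; move: B g; apply: contrapT => nlb.
have lt_resolvent l : l < lambda1 G -> resolvent_set G l.
  move=> ll; apply: contrapT => nl.
  (* [inf] is 0 on sets without an infimum, which positivity excludes *)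
  have hi : has_inf (spectrum G).
    by apply: contrapT => h; move: lam0; rewrite /lambda1 inf_out// ltxx.
  by move: ll; apply/negP; rewrite -leNgt; apply: ge_inf => //; case: hi.
pose U := [set l | lower_bound l].
have ub : ubound U (lambda1 G).
  move=> l Ul; rewrite leNgt; apply/negP => ll; apply: nlb => B g.
  by apply: le_trans (Ul B g); rewrite ler_wpM2r// ltW.
have hs : has_sup U by split; [exists 0; exact: lower_bound0|exists (lambda1 G)].
have Um : lower_bound (sup U).
  move=> B g; have [s0|sn] := eqVneq (sq g) 0.
    by have := @lower_bound0 B g; rewrite s0 !mulr0.
  have sp : 0 < sq g by rewrite lt_def sn sq_ge0.
  rewrite -ler_pdivlMr//; apply: ge_sup; first by case: hs.
  by move=> l Ul; rewrite ler_pdivlMr//; exact: Ul.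
have m0 : 0 <= sup U by apply: ub_le_sup; [case: hs|exact: lower_bound0].
have ml : sup U < lambda1 G.
  rewrite lt_neqAle ge_sup ?andbT//; last by case: hs.
  by apply/eqP => E; apply: nlb; rewrite -E.
have [e e0 Ue] := resolvent_not_bottom m0 Um (lt_resolvent _ ml).
have : sup U + e <= sup U by apply: ub_le_sup; [case: hs|].
by rewrite gerDl leNgt e0.
Qed.

End SpectralGap.

(** * The discrete square function on a graph *)

Section DiscreteSquareFunction.
Context {R : realType} {V : choiceType} (G : weighted_graph R V).
Implicit Types (f g : V -> R) (B : {fset V}).

(** An edge is a set; ordering its endpoints turns sums over edges into sums
    over pairs of vertices of a finite set. *)
Lemma edge_endpoints (s : seq (set V)) : {in s, forall e, edges G e} ->
  exists B0 : {fset V}, forall B, (B0 `<=` B)%fset ->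
  exists z : seq (B * B), s = [seq [set val t.1; val t.2] | t <- z].
Proof.
elim: s => [|e s IH] es; first by exists fset0 => B _; exists [::].
have [B0 HB0] : exists B0 : {fset V}, forall B, (B0 `<=` B)%fset ->
    exists z : seq (B * B), s = [seq [set val t.1; val t.2] | t <- z].
  by apply: IH => e' e's; apply: es; rewrite inE e's orbT.
have [|x [y exy]] := edgesP (w := G) (e := e); first by apply: es; rewrite inE eqxx.
exists (x |` (y |` B0))%fset => B sB.
have xB : x \in B by apply: (fsubsetP sB); rewrite !inE eqxx.
have yB : y \in B by apply: (fsubsetP sB); rewrite !inE eqxx orbT.
have [|z ez] := HB0 B.
  by apply: fsubset_trans sB; rewrite (fsubset_trans (fsubsetU1 y _))// fsubsetU1.
by exists (([` xB]%fset, [` yB]%fset) :: z); rewrite /= -ez exy.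
Qed.

Lemma le_sum_uniq (T : finType) (z : seq T) (F : T -> R) : uniq z ->
  (forall t, 0 <= F t) -> \sum_(t <- z) F t <= \sum_t F t.
Proof.
move=> uz F0; rewrite big_uniq//= big_mkcond/=; apply: ler_sum => t _.
by case: ifP.
Qed.

Definition lpV_mass (p : R) f := \sum_(x \in [set: V]) vertex_weight G x * `|f x| `^ p.

Lemma lpV_mass_restrict p B f : 0 < p -> supported_in B f ->
  lpV_mass p f = lp_mass (fun x : B => vertex_weight G (val x)) p (f \o val).
Proof.
move=> p0 sf; apply: fsum_fset => x /sf->.
by rewrite normr0 powR0 ?mulr0// gt_eqF.
Qed.

Lemma lpV_norm_mass p f : 0 < p -> finitely_supported f ->
  lpV_norm G p f = (lpV_mass p f `^ p^-1)%:E.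
Proof.
move=> p0 /finitely_supportedP[B sB].
by rewrite (lpV_norm_fset _ p0 sB) (lpV_mass_restrict p0 sB).
Qed.

Lemma lpV_mass_ge0 p f : 0 <= lpV_mass p f.
Proof.
by apply: fsumr_ge0 => x _; rewrite mulr_ge0 ?powR_ge0// ltW// vertex_weight_gt0.
Qed.

Variable M : R.
Hypothesis degM : forall x, deg G x <= M * vertex_weight G x.
Variables (tau p : R).
Hypotheses (tau0 : 0 < tau) (tauM : tau * M <= 2^-1) (p1 : 1 < p) (p2 : p <= 2).

Definition fset_walk B (x y : B) : R :=
  lazy_walk (fun x : B => vertex_weight G (val x))
    (fun x y => mu G (val x) (val y)) (fun x => deg G (val x)) tau x y.

Let nuB B (x : B) := vertex_weight G (val x).

Lemma fset_walk_kernel B : symmetric_kernel (@nuB B) (@fset_walk B).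
Proof.
apply: lazy_walk_symmetric_kernel tau0 tauM => [x|x y|x y|x|x].
- exact: vertex_weight_gt0.
- exact: mu_ge0.
- exact: muC.
- exact: sum_mu_le_deg.
- exact: degM.
Qed.

Definition square_constant (C : R) : R :=
  4 `^ (p / 2) * ((2 / (p - 1) ^+ 2) `^ (p / 2)
    * (4 * (p / (p - 1)) `^ p) `^ (1 - p / 2) * (3 * C) `^ (p / 2)).

Lemma discrete_square_function (r C : R) f (s : seq (set V)) n :
  0 <= r -> 0 <= C ->
  (forall B, dissipation_bound (@nuB B) (@fset_walk B) p r C) ->
  finitely_supported f -> uniq s -> {in s, forall e, edges G e} ->
  \sum_(e <- s) edge_weight G e *
    (\sum_(j < n) r ^+ j * grad (iter j (walk G tau) f) e ^+ 2) `^ (p / 2) <=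
  tau^-1 * square_constant C * lpV_mass p f.
Proof.
move=> r0 C0 diss fin us es.
have [B0 HB0] := edge_endpoints es.
have [B BB sB] := iter_walk_supported G tau n B0 fin.
have [z ez] := HB0 _ BB.
have uz : uniq z by apply: (@map_uniq _ _ (fun t : B * B => [set val t.1; val t.2])); rewrite -ez.
have sf : supported_in B f := sB 0%N (leq0n _).
rewrite (lpV_mass_restrict (lt_trans ltr01 p1) sf).
pose S (x y : B) := \sum_(j < n) r ^+ j * (iter j (kop (@fset_walk B)) (f \o val) x
  - iter j (kop (@fset_walk B)) (f \o val) y) ^+ 2.
have S0 x y : 0 <= S x y `^ (p / 2) by exact: powR_ge0.
have -> : \sum_(e <- s) edge_weight G e *
    (\sum_(j < n) r ^+ j * grad (iter j (walk G tau) f) e ^+ 2) `^ (p / 2) =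
    \sum_(t <- z) mu G (val t.1) (val t.2) * S t.1 t.2 `^ (p / 2).
  rewrite ez big_map big_seq [RHS]big_seq; apply: eq_bigr => -[x y] xyz /=.
  congr (_ * _ `^ _).
    by rewrite /mu /adj ifT// inE; apply: es; rewrite ez; apply/mapP; exists (x, y).
  apply: eq_bigr => j _; rewrite gradE real_normK ?num_real//.
  rewrite !(@iter_walk_dirichlet _ _ G B)// => i ij; apply: sB;
    exact: ltnW (ltn_trans ij (ltn_ord j)).
apply: le_trans (le_sum_uniq uz _) _.
  by move=> t; rewrite mulr_ge0// mu_ge0.
rewrite -(pair_bigA _ (fun x y : B => mu G (val x) (val y) * S x y `^ (p / 2)))/=.
have lazy (x : B) : 2^-1 <= fset_walk x x.
  exact: (lazy_walk_lazy (fun _ => vertex_weight_gt0 _ _)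
    (fun _ _ => mu_ge0 _ _ _) (fun _ => degM _) tau0 tauM).
have := @square_function _ _ _ _ (@fset_walk_kernel B) p p1 p2 lazy r C r0 C0
  (f \o val) n (diss B n).
rewrite -/(square_constant C) => H.
rewrite -mulrA ler_pdivlMl// (le_trans _ H)// mulr_sumr.
apply: ler_sum => x _; rewrite mulr_sumr; apply: ler_sum => y _.
rewrite mulrA ler_wpM2r//.
exact: (@le_lazy_walk _ _ (@nuB B) (fun x y => mu G (val x) (val y)) _ M
  (fun _ => vertex_weight_gt0 _ _) (fun _ => degM _) _ tau0 tauM).
Qed.

End DiscreteSquareFunction.

(** * The heat semigroup as a Poisson average of the walk *)

Section CauchyProduct.
Context {R : realType}.
Implicit Types (u v : nat -> R).

Lemma cvg0_norm_le u v : (forall n, `|u n| <= v n) ->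
  v @ \oo --> 0 -> u @ \oo --> 0.
Proof.
move=> uv v0; apply/norm_cvg0P; apply: squeeze_cvgr (cvg_cst 0) v0.
by apply: nearW => n; rewrite normr_ge0 uv.
Qed.

Lemma sum_triangle (F : nat -> nat -> R) n :
  \sum_(m < n) \sum_(k < m.+1) F (m - k)%N k =
  \sum_(k < n) \sum_(0 <= i < n - k) F i k.
Proof.
transitivity (\sum_(m < n) \sum_(k < n | (k <= m)%N) F (m - k)%N k).
  apply: eq_bigr => m _.
  by rewrite (big_ord_widen n (fun k => F (m - k)%N k)).
rewrite (exchange_big_dep xpredT)//=; apply: eq_bigr => k _.
rewrite -(big_mkord (fun m => (k <= m)%N) (fun m => F (m - k)%N k)).
rewrite (big_cat_nat _ (n := k)) //=; last exact: ltnW.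
rewrite big_nat_cond big_pred0 ?add0r; last first.
  by move=> i; apply/negbTE; rewrite leq0n /= ltnNge; case: (k <= i)%N.
rewrite -[X in \sum_(X <= _ < _ | _) _]add0n big_addn; apply: eq_big => i.
  by rewrite leq_addl.
by rewrite addnK.
Qed.

Lemma sum_square_sub_triangle (F : nat -> nat -> R) n :
  \sum_(k < n) \sum_(i < n) F i k - \sum_(m < n) \sum_(k < m.+1) F (m - k)%N k =
  \sum_(k < n) \sum_(n - k <= i < n) F i k.
Proof.
rewrite sum_triangle -sumrB; apply: eq_bigr => k _.
rewrite -(big_mkord xpredT (F ^~ k)) (big_cat_nat _ (n := (n - k)%N)) ?leq_subr//=.
by rewrite addrAC subrr add0r.
Qed.

Lemma exp_coeff_conv (x y : R) n :
  \sum_(k < n.+1) exp_coeff x (n - k)%N * exp_coeff y k = exp_coeff (x + y) n.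
Proof.
rewrite /exp_coeff /= exprDn mulr_suml; apply: eq_bigr => k _.
have kn : (k <= n)%N by rewrite -ltnS.
have := bin_fact kn => /(congr1 (fun z => z%:R : R)); rewrite !natrM => e.
have nz (i : nat) : (i`!%:R : R) != 0 by rewrite pnatr_eq0 -lt0n fact_gt0.
rewrite -[_ *+ 'C(n, k)]mulr_natr.
have -> : ('C(n, k)%:R : R) = n`!%:R / (k`!%:R * (n - k)`!%:R).
  by rewrite -e mulfK// mulf_neq0.
by field; rewrite !nz.
Qed.

(** The part of the square above the antidiagonal is dominated, term by term, by
    the same part for two exponential series of nonnegative arguments, where it
    tends to 0 because [expR] is multiplicative. *)
Lemma cauchy_product_exp (x y B : R) (b : nat -> R) : (forall k, `|b k| <= B) ->
  (fun n => expR x * \sum_(k < n) exp_coeff y k * b k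
    - \sum_(m < n) \sum_(k < m.+1) exp_coeff x (m - k)%N * (exp_coeff y k * b k))
  @ \oo --> 0.
Proof.
move=> bB.
have B0 : 0 <= B by exact: le_trans (normr_ge0 _) (bB 0%N).
pose E (z : R) n := \sum_(i < n) exp_coeff z i.
have cE z : E z @ \oo --> expR z.
  have -> : E z = series (exp_coeff z).
    by apply/funext => n; rewrite /series/= big_mkord.
  exact: is_cvg_series_exp_coeff.
pose W n := \sum_(k < n) exp_coeff y k * b k.
have absE z i : `|exp_coeff z i| = exp_coeff `|z| i.
  by rewrite /exp_coeff /= normrM normfV normrX normr_nat.
have E_le z n : 0 <= z -> E z n <= expR z.
  move=> z0; rewrite -(cvg_lim (@Rhausdorff R) (cE z)).
  apply: (@nondecreasing_cvgn_le R (E z)); last by apply: cvgP; exact: cE.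
  apply/nondecreasing_seqP => m; rewrite /E big_ord_recr/= lerDl.
  exact: exp_coeff_ge0.
have W_le n : `|W n| <= B * expR `|y|.
  apply: (@le_trans _ _ (\sum_(k < n) B * exp_coeff `|y| k)).
    apply: le_trans (ler_norm_sum _ _ _) _; apply: ler_sum => k _.
    by rewrite normrM absE mulrC ler_wpM2r ?exp_coeff_ge0.
  by rewrite -mulr_sumr ler_wpM2l// E_le.
have first : (fun n => (expR x - E x n) * W n) @ \oo --> 0.
  have h : (fun n => `|expR x - E x n| * (B * expR `|y|)) @ \oo --> 0.
    rewrite -(mul0r (B * expR `|y|)); apply: cvgMl.
    rewrite -(normr0 R) -(subrr (expR x)); apply: cvg_norm; apply: cvgB => //.
    exact: cvg_cst.
  by apply: cvg0_norm_le h => n; rewrite normrM ler_wpM2l.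
have second : (fun n => E x n * W n -
    \sum_(m < n) \sum_(k < m.+1) exp_coeff x (m - k)%N * (exp_coeff y k * b k))
    @ \oo --> 0.
  have h : (fun n => B * (E `|x| n * E `|y| n - E (`|x| + `|y|) n)) @ \oo --> 0.
    rewrite -(mulr0 B); apply: cvgMr.
    rewrite -(subrr (expR (`|x| + `|y|))) {1}expRD.
    by apply: cvgB => //; apply: cvgM.
  apply: cvg0_norm_le h => n.
  have prod (a c : nat -> R) : (\sum_(i < n) a i) * (\sum_(k < n) c k) =
      \sum_(k < n) \sum_(i < n) a i * c k.
    by rewrite mulr_sumr; apply: eq_bigr => k _; rewrite mulr_suml.
  have -> : E `|x| n * E `|y| n - E (`|x| + `|y|) n =
     \sum_(k < n) \sum_(n - k <= i < n) exp_coeff `|x| i * exp_coeff `|y| k.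
    rewrite -(sum_square_sub_triangle (fun i k => exp_coeff `|x| i * exp_coeff `|y| k)).
    rewrite /E prod; congr (_ - _); apply: eq_bigr => m _.
    by rewrite -exp_coeff_conv.
  rewrite /E /W (prod _ (fun k => exp_coeff y k * b k)).
  rewrite (sum_square_sub_triangle (fun i k => exp_coeff x i * (exp_coeff y k * b k))).
  rewrite mulr_sumr; apply: le_trans (ler_norm_sum _ _ _) _; apply: ler_sum => k _.
  rewrite mulr_sumr; apply: le_trans (ler_norm_sum _ _ _) _; apply: ler_sum => i _.
  rewrite normrM (normrM (exp_coeff y k)) !absE [leRHS]mulrC -[leRHS]mulrA.
  by rewrite ler_wpM2l ?exp_coeff_ge0// ler_wpM2l ?exp_coeff_ge0.
have /(_ _) h := cvgD first second; rewrite addr0 in h.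
refine (cvg_trans _ h); apply: near_eq_cvg; apply: nearW => n.
by rewrite /W fctE; ring.
Qed.

End CauchyProduct.

Section Heat.
Context {R : realType} {V : choiceType} (G : weighted_graph R V).
Implicit Types (f g : V -> R).
Variable M : R.
Hypothesis degM : forall x, deg G x <= M * vertex_weight G x.
Variable tau : R.
Hypotheses (tau0 : 0 < tau) (tauM : tau * M <= 2^-1).

Let P := walk G tau.

Lemma laplacian_neighbors f x : laplacian G f x =
  (vertex_weight G x)^-1 * \sum_(y <- neighbors G x) mu G x y * (f x - f y).
Proof.
rewrite /laplacian (fsbigTE (neighbors G x))// => y yN.
by rewrite (supported_mu yN) mul0r.
Qed.

Lemma walk_lincomb n (c : nat -> R) (h : nat -> V -> R) x :
  P (fun y => \sum_(k < n) c k * h k y) x = \sum_(k < n) c k * P (h k) x.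
Proof.
rewrite /P /walk laplacian_neighbors.
under [X in _ = X]eq_bigr do rewrite mulrBr laplacian_neighbors.
rewrite sumrB; congr (_ - _).
rewrite [RHS](eq_bigr (fun k : 'I_n => tau * ((vertex_weight G x)^-1 *
  \sum_(y <- neighbors G x) mu G x y * (c k * h k x - c k * h k y)))); last first.
  move=> k _; rewrite mulrCA; congr (_ * _); rewrite mulrCA; congr (_ * _).
  by rewrite mulr_sumr; apply: eq_bigr => y _; ring.
rewrite -!mulr_sumr exchange_big/=; congr (_ * (_ * _)).
by apply: eq_bigr => y _; rewrite -mulr_sumr sumrB.
Qed.

Lemma iter_laplacian n f x : iter n (laplacian G) f x =
  \sum_(k < n.+1) (-1) ^+ k * 'C(n, k)%:R / tau ^+ n * iter k P f x.
Proof.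
have tn : tau != 0 by rewrite gt_eqF.
have tnn m : tau ^+ m != 0 by rewrite expf_neq0.
have lapE g y : laplacian G g y = (g y - P g y) / tau.
  by rewrite /P /walk; field.
elim: n x => [|n IH] x.
  by rewrite big_ord1 expr0 bin0 invr1 !mul1r.
pose c m k : R := (-1) ^+ k * 'C(m, k)%:R / tau ^+ m.
rewrite iterS lapE (_ : iter n _ f = fun y => \sum_(k < n.+1) c n k * iter k P f y);
  last by apply/funext.
rewrite (walk_lincomb _ (c n) (fun k => iter k P f)).
pose d k : R := (-1) ^+ k * 'C(n, k)%:R.
have -> : \sum_(k < n.+1) c n k * iter k P f x =
    (tau ^+ n)^-1 * \sum_(k < n.+2) d k * iter k P f x.
  rewrite [in RHS]big_ord_recr/= [d n.+1]/d bin_small// mulr0 mul0r addr0 mulr_sumr.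
  by apply: eq_bigr => k _; rewrite /c /d; ring.
rewrite big_ord_recl [RHS]big_ord_recl/= /d !bin0 !expr0 /bump /=.
rewrite (eq_bigr (fun k : 'I_n.+1 => (tau ^+ n * tau) *
  ((-1) ^+ (1 + k) * 'C(n.+1, 1 + k)%:R / tau ^+ n.+1 * P (iter k P f) x)
  + d k * P (iter k P f) x)); last first.
  by move=> k _; rewrite /d add1n binS natrD -exprSr [(-1) ^+ k.+1]exprS;
    field; rewrite ?tnn ?tn.
rewrite big_split/= -mulr_sumr.
have -> : \sum_(k < n.+1) c n k * P (iter k P f) x =
    (tau ^+ n)^-1 * \sum_(k < n.+1) d k * P (iter k P f) x.
  by rewrite mulr_sumr; apply: eq_bigr => k _; rewrite /c /d; ring.
by rewrite exprSr; field; rewrite ?tnn ?tn.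
Qed.

Lemma walk_bounded f b : finitely_supported f -> (forall x, `|f x| <= b) ->
  forall x, `|P f x| <= b.
Proof.
move=> /finitely_supportedP[B sB] fb x.
have b0 : 0 <= b by exact: le_trans (fb x).
have nx : 0 < vertex_weight G x by exact: vertex_weight_gt0.
have tn0 : 0 <= tau / vertex_weight G x by rewrite divr_ge0// ltW.
rewrite /P /walk (laplacian_restrict G x sB).
have -> : f x - tau * ((vertex_weight G x)^-1 *
    (deg G x * f x - \sum_(y : B) mu G x (val y) * f (val y))) =
    (1 - tau * (deg G x / vertex_weight G x)) * f x +
    tau / vertex_weight G x * \sum_(y : B) mu G x (val y) * f (val y) by ring.
have d1 : 0 <= 1 - tau * (deg G x / vertex_weight G x).
  have : tau * (deg G x / vertex_weight G x) <= tau * M.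
    by rewrite ler_pM2l// ler_pdivrMr.
  by move: tauM; lra.
have h1 : `|\sum_(y : B) mu G x (val y) * f (val y)| <= deg G x * b.
  apply: le_trans (ler_norm_sum _ _ _) _.
  apply: (@le_trans _ _ (\sum_(y : B) mu G x (val y) * b)).
    apply: ler_sum => y _; rewrite normrM (ger0_norm (mu_ge0 _ _ _)).
    by rewrite ler_wpM2l// mu_ge0.
  by rewrite -mulr_suml ler_wpM2r// sum_mu_le_deg.
apply: le_trans (ler_normD _ _) _; rewrite (normrM (1 - _)) (normrM (tau / _)) (ger0_norm d1) (ger0_norm tn0).
have h2 := ler_wpM2l d1 (fb x).
have h3 := ler_wpM2l tn0 h1.
apply: le_trans (lerD h2 h3) _.
by rewrite le_eqVlt; apply/orP; left; apply/eqP; ring.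
Qed.

Lemma iter_walk_bounded f : finitely_supported f ->
  exists b, forall n x, `|iter n P f x| <= b.
Proof.
move=> fin; have [B sB] := (finitely_supportedP f).1 fin.
exists (\sum_(y : B) `|f (val y)|); elim=> [|n IH] x /=; last first.
  by apply: walk_bounded => //; exact: iter_walk_finite.
have [xB|/sB->] := boolP (x \in B); last by rewrite normr0 sumr_ge0.
by rewrite (bigD1 [` xB]%fset)//= lerDl sumr_ge0.
Qed.

End Heat.

(** * A Gamma integral *)

Section GammaIntegral.
Context {R : realType}.
Variable c : R.
Hypothesis c0 : 0 < c.

Definition gamma_weight (k : nat) (t : R) : R := expR (- (c * t)) * exp_coeff t k.

Lemma is_derive_expRN (t : R) :
  is_derive t 1 (fun t => expR (- (c * t))) (- c * expR (- (c * t))).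
Proof.
have H : is_derive t 1 (fun t : R => - (c * t)) (- c).
  apply: is_derive_eq; rewrite ?mulr1//.
  by rewrite -[_ *: _]/(_ * _) mulr1.
by have := is_derive1_comp (is_derive_expR _) H; rewrite mulrC.
Qed.

Lemma is_derive_exp_coeff (t : R) k :
  is_derive t 1 (fun t => exp_coeff t k.+1) (exp_coeff t k).
Proof.
rewrite /exp_coeff/=.
have -> : (fun t : R => t ^+ k.+1 / (k.+1)`!%:R) = (k.+1)`!%:R^-1 \*: (id ^+ k.+1).
  by apply/funext => u /=; rewrite exprfctE mulrC.
have h := is_deriveZ (k.+1)`!%:R^-1 (is_deriveX k.+1 (is_derive_id t (1 : R))).
apply: (is_derive_eq h).
rewrite /= -![_ *: _]/(_ * _) factS natrM invfM.
have nz : (k.+1%:R : R) != 0 by rewrite pnatr_eq0.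
have nf : (k`!%:R : R) != 0 by rewrite pnatr_eq0 -lt0n fact_gt0.
move: (k.+1%:R : R) (k`!%:R : R) nz nf => a b nz nf.
by rewrite mulr1; field; rewrite nf nz.
Qed.

Lemma is_derive_gamma_weight k (t : R) : is_derive t 1 (gamma_weight k.+1)
  (gamma_weight k t - c * gamma_weight k.+1 t).
Proof.
have h1 := is_derive_expRN t; have h2 := is_derive_exp_coeff t k.
apply: (@is_derive_eq _ _ _ _ _ _ _ _ (is_deriveM h1 h2)).
rewrite /gamma_weight -![_ *: _]/(_ * _); ring.
Qed.

Lemma gamma_weight_ge0 k t : 0 <= t -> 0 <= gamma_weight k t.
Proof. by move=> t0; rewrite mulr_ge0 ?expR_ge0 ?exp_coeff_ge0. Qed.

Lemma continuous_gamma_weight k : continuous (gamma_weight k).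
Proof.
move=> t; apply: cvgM.
  apply: continuous_comp; last exact: continuous_expR.
  by apply: cvgN; apply: cvgMr.
by apply: cvgMl; exact: exprn_continuous.
Qed.

Lemma gamma_weight_cvgy k : gamma_weight k t @[t --> +oo] --> 0.
Proof.
have up : (k.+1%:R / c ^+ k.+1) * t^-1 @[t --> +oo] --> (0 : R).
  rewrite -(mulr0 (k.+1%:R / c ^+ k.+1)); apply: cvgMr.
  apply/(@gtr0_cvgV0 R _ _ _ (fun t => t)); last exact: cvg_id.
  exact: nbhs_pinfty_gt.
apply: (@squeeze_cvgr _ _ _ _ (fun=> 0) _ _ _ 0 _ up); last exact: cvg_cst.
near=> t.
have t0 : 0 < t by near: t; exact: nbhs_pinfty_gt.
rewrite gamma_weight_ge0 ?(ltW t0)//=.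
rewrite /gamma_weight expRN /exp_coeff/=.
have ct : 0 <= c * t by rewrite mulr_ge0 ?ltW.
have h := expR_ge1Dxn k ct.
have h2 : (c * t) ^+ k.+1 / (k.+1)`!%:R <= expR (c * t).
  by apply: le_trans h; rewrite lerDr.
rewrite ler_pdivrMl ?expR_gt0//.
have cn : c != 0 by rewrite gt_eqF.
have tn : t != 0 by rewrite gt_eqF.
have f0 : (k`!%:R : R) != 0 by rewrite pnatr_eq0 -lt0n fact_gt0.
have k0 : (k.+1%:R : R) != 0 by rewrite pnatr_eq0.
have A0 : 0 <= k.+1%:R / c ^+ k.+1 / t.
  by rewrite !divr_ge0 ?exprn_ge0 ?ltW.
apply: le_trans (ler_wpM2r A0 h2).
rewrite le_eqVlt; apply/orP; left; apply/eqP.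
rewrite factS natrM exprMn !exprSr.
have Cn : c ^+ k != 0 by rewrite expf_neq0.
move: (k.+1%:R : R) (k`!%:R : R) (c ^+ k) k0 f0 Cn {A0 h2 h up} => a b C an bn Cn.
by field; rewrite an bn tn cn Cn.
Unshelve. all: by end_near. Qed.

(** The result of [k] integrations by parts, written recursively. *)
Fixpoint gamma_primitive (k : nat) (t : R) : R :=
  match k with
  | 0 => - (c^-1 * gamma_weight 0 t)
  | k'.+1 => c^-1 * (gamma_primitive k' t - gamma_weight k t)
  end.

Lemma is_derive_gamma_primitive k (t : R) :
  is_derive t 1 (gamma_primitive k) (gamma_weight k t).
Proof.
have cn : c != 0 by rewrite gt_eqF.
elim: k => [|k IH].
  have -> : gamma_primitive 0 = (- c^-1) \*o (fun t => expR (- (c * t))).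
    by apply/funext => u /=; rewrite /gamma_weight /exp_coeff/= expr0 fact0 divr1 mulr1 mulNr.
  have h := is_derive_expRN t.
  apply: is_derive_eq.
  rewrite -[_ *: _]/(_ * _) /gamma_weight /exp_coeff/= expr0 fact0 divr1 mulr1; field.
  by rewrite cn.
have -> : gamma_primitive k.+1 = c^-1 \*o (gamma_primitive k - gamma_weight k.+1).
  by [].
have h := is_derive_gamma_weight k t.
apply: is_derive_eq.
rewrite -[_ *: _]/(_ * _); field.
by rewrite cn.
Qed.

Lemma gamma_primitive0 k : gamma_primitive k 0 = - c ^- k.+1.
Proof.
elim: k => [|k IH] /=; rewrite /gamma_weight mulr0 oppr0 expR0 /exp_coeff/= mul1r.
  by rewrite expr0 fact0 divr1 mulr1 expr1.
by rewrite IH expr0n mul0r subr0 mulrN -invfM -exprS.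
Qed.

Lemma gamma_primitive_cvgy k : gamma_primitive k t @[t --> +oo] --> 0.
Proof.
elim: k => [|k IH].
  rewrite -oppr0; apply: cvgN; rewrite -(mulr0 c^-1); apply: cvgMr.
  exact: gamma_weight_cvgy.
rewrite -(mulr0 c^-1); apply: cvgMr; rewrite -(subr0 0).
by apply: cvgB => //; exact: gamma_weight_cvgy.
Qed.

Lemma integral_gamma_weight k :
  (\int[lebesgue_measure]_(t in `[0%R, +oo[) (gamma_weight k t)%:E = (c ^- k.+1)%:E)%E.
Proof.
have cont x : {for x, continuous (gamma_primitive k)}.
  apply: differentiable_continuous; apply/derivable1_diffP.
  by case: (is_derive_gamma_primitive k x).
rewrite (@ge0_continuous_FTC2y _ _ (gamma_primitive k) 0 0).
- by rewrite gamma_primitive0 EFinN oppeK add0e.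
- by move=> x; exact: gamma_weight_ge0.
- by apply: continuous_subspaceT; exact: continuous_gamma_weight.
- exact: gamma_primitive_cvgy.
- by move=> x _; case: (is_derive_gamma_primitive k x).
- by apply: cvg_at_right_filter; exact: cont.
- move=> x _; rewrite derive1E.
  by case: (is_derive_gamma_primitive k x).
Qed.

End GammaIntegral.

(** * Comparison of the heat and the discrete square functions *)

(** Cauchy-Schwarz for weights of total mass at most [E], from the expansion of
    the sum of [w i * (E * d i - A) ^+ 2], with [A] the weighted sum of [d]. *)
Lemma sqr_weighted_sum_le (R : realType) (I : Type) (s : seq I) (w d : I -> R) (E : R) :
  (forall i, 0 <= w i) -> 0 < E -> \sum_(i <- s) w i <= E ->
  (\sum_(i <- s) w i * d i) ^+ 2 <= E * \sum_(i <- s) w i * d i ^+ 2.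
Proof.
move=> w0 E0 wE; set A := \sum_(i <- s) w i * d i.
set Q := \sum_(i <- s) w i * d i ^+ 2.
have : 0 <= \sum_(i <- s) w i * (E * d i - A) ^+ 2.
  by apply: sumr_ge0 => i _; rewrite mulr_ge0// sqr_ge0.
rewrite (eq_bigr (fun i => E ^+ 2 * (w i * d i ^+ 2) - 2 * E * A * (w i * d i)
  + A ^+ 2 * w i)); last by move=> i _; ring.
rewrite big_split/= sumrB -!mulr_sumr -/A -/Q => h.
have h2 := ler_wpM2l (sqr_ge0 A) wE.
have : 0 <= E * (E * Q - A ^+ 2).
  move: h h2; set S := \sum_(i <- s) w i; lra.
by rewrite pmulr_rge0// subr_ge0.
Qed.

Section HeatSquareFunction.
Context {R : realType} {V : choiceType} (G : weighted_graph R V).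
Implicit Types (f g : V -> R).
Variable M : R.
Hypothesis degM : forall x, deg G x <= M * vertex_weight G x.
Variable tau : R.
Hypotheses (tau0 : 0 < tau) (tauM : tau * M <= 2^-1).

Let P := walk G tau.

Definition poisson_sum (f : V -> R) (x : V) (t : R) (n : nat) : R :=
  expR (- (t / tau)) * \sum_(k < n) exp_coeff (t / tau) k * iter k P f x.

(** Since [Delta = (1 - P) / tau], the heat semigroup is the walk observed at
    the times of a Poisson process. *)
Lemma heat_poisson f x t : finitely_supported f ->
  poisson_sum f x t @ \oo --> heat G t f x.
Proof.
move=> fin; have [b fb] := iter_walk_bounded degM tau0 tauM fin.
have b0 : 0 <= b by exact: le_trans (normr_ge0 _) (fb 0%N x).
pose s := t / tau.
pose term m := (- t) ^+ m / m`!%:R * iter m (laplacian G) f x.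
have termE m : term m =
    \sum_(k < m.+1) exp_coeff (- s) (m - k)%N * (exp_coeff s k * iter k P f x).
  rewrite /term (iter_laplacian G tau0) mulr_sumr; apply: eq_bigr => k _.
  rewrite /exp_coeff/= /s -mulNr !expr_div_n.
  have km : (k <= m)%N by rewrite -ltnS.
  have := bin_fact km => /(congr1 (fun z => z%:R : R)); rewrite !natrM => e.
  have nz (i : nat) : (i`!%:R : R) != 0 by rewrite pnatr_eq0 -lt0n fact_gt0.
  have -> : ('C(m, k)%:R : R) = m`!%:R / (k`!%:R * (m - k)`!%:R).
    by rewrite -e mulfK// mulf_neq0.
  have tk : t ^+ k = (-1) ^+ k * (- t) ^+ k by rewrite -exprMn mulN1r opprK.
  have tm : (- t) ^+ m = (- t) ^+ (m - k) * (- t) ^+ k.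
    by rewrite -exprD subnK.
  have um : tau ^+ m = tau ^+ (m - k) * tau ^+ k by rewrite -exprD subnK.
  have tn i : tau ^+ i != 0 by rewrite expf_neq0// gt_eqF.
  rewrite tk tm um.
  move: (m`!%:R : R) (k`!%:R : R) ((m - k)`!%:R : R) (tau ^+ (m - k)) (tau ^+ k)
    (nz m) (nz k) (nz (m - k)%N) (tn (m - k)%N) (tn k) => A1 A2 A3 A4 A5 n1 n2 n3 n4 n5.
  by field; rewrite n1 n2 n3 n4 n5.
have conv := cauchy_product_exp (- s) s (fun k => fb k x).
have cW : cvgn (fun n => \sum_(k < n) exp_coeff s k * iter k P f x).
  have -> : (fun n => \sum_(k < n) exp_coeff s k * iter k P f x) =
      series (fun k => exp_coeff s k * iter k P f x).
    by apply/funext => n; rewrite /series/= big_mkord.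
  apply: normed_cvg.
  apply: (@series_le_cvg R _ (b *: exp_coeff `|s|)) => [n|n|n|].
  - exact: normr_ge0.
  - by rewrite mulr_ge0// exp_coeff_ge0.
  - rewrite /= normrM mulrC ler_pM// /exp_coeff/= normrM normfV normrX normr_nat//.
  - by apply: is_cvg_seriesZ; exact: is_cvg_series_exp_coeff.
have cA : cvgn (poisson_sum f x t).
  by apply: is_cvgMr.
have serE : series term = (fun n => \sum_(m < n) \sum_(k < m.+1)
    exp_coeff (- s) (m - k)%N * (exp_coeff s k * iter k P f x)).
  apply/funext => n; rewrite /series/= big_mkord.
  by apply: eq_bigr => m _; exact: termE.
have hE : series term @ \oo --> limn (poisson_sum f x t).
  have /(_ _) h := cvgB cA conv; rewrite subr0 in h.
  refine (cvg_trans _ h); apply: near_eq_cvg; apply: nearW => n.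
  by rewrite serE /poisson_sum !fctE /s /P; ring.
rewrite /heat -/term (cvg_lim _ hE)//.
Qed.

Lemma measurable_poisson_sum f x n D :
  measurable_fun D (fun t => poisson_sum f x t n).
Proof.
apply: measurable_funTS; apply: measurable_funM.
  apply: measurableT_comp => //; apply: measurable_funN.
  by apply: measurable_funM.
apply: measurable_sum => k; apply: measurable_funM => //.
apply: measurable_funM => //; apply: measurable_funX.
exact: measurable_funM.
Qed.

Lemma measurable_heat f x D : measurable D -> finitely_supported f ->
  measurable_fun D (fun t => heat G t f x).
Proof.
move=> mD fin.
apply: (measurable_fun_cvg (h := fun n t => poisson_sum f x t n)) => [n|t _].
  exact: measurable_poisson_sum.
exact: heat_poisson.
Qed.

Lemma exp_coeff_sum_le (s : R) n : 0 <= s -> \sum_(k < n) exp_coeff s k <= expR s.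
Proof.
move=> s0.
have -> : \sum_(k < n) exp_coeff s k = series (exp_coeff s) n.
  by rewrite /series/= big_mkord.
apply: nondecreasing_cvgn_le; last exact: is_cvg_series_exp_coeff.
apply/nondecreasing_seqP => m; rewrite /series/= big_nat_recr//= lerDl.
exact: exp_coeff_ge0.
Qed.

(** Jensen's inequality for the Poisson average, on partial sums and then in the
    limit. *)
Lemma grad_heat_sq_le f e t : finitely_supported f -> edges G e -> 0 <= t ->
  ((grad (heat G t f) e ^+ 2)%:E <= \sum_(k <oo)
    (expR (- (t / tau)) * exp_coeff (t / tau) k * grad (iter k P f) e ^+ 2)%:E)%E.
Proof.
move=> fin /edgesP[x [y ->]] t0; set s := t / tau.
have s0 : 0 <= s by rewrite divr_ge0// ltW.
rewrite gradE real_normK ?num_real//.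
have hx := @heat_poisson f x t fin; have hy := @heat_poisson f y t fin.
pose u k : R := expR (- s) * exp_coeff s k * grad (iter k P f) [set x; y] ^+ 2.
have u0 k : 0 <= u k.
  apply: mulr_ge0; last exact: sqr_ge0.
  by apply: mulr_ge0; [exact: expR_ge0|exact: exp_coeff_ge0].
have bound n : (poisson_sum f x t n - poisson_sum f y t n) ^+ 2 <= \sum_(k < n) u k.
  rewrite /poisson_sum -/s -mulrBr -sumrB.
  rewrite (eq_bigr (fun k : 'I_n => exp_coeff s k * (iter k P f x - iter k P f y)));
    last by move=> k _; rewrite mulrBr.
  have := @sqr_weighted_sum_le R _ (index_enum 'I_n) (fun k => exp_coeff s k)
    (fun k => iter k P f x - iter k P f y) (expR s)
    (fun k => exp_coeff_ge0 _ s0) (expR_gt0 s) (exp_coeff_sum_le n s0).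
  move=> /(ler_wpM2l (sqr_ge0 (expR (- s)))); rewrite -exprMn => /le_trans; apply.
  rewrite expRN -expRN mulrA.
  have -> : expR (- s) ^+ 2 * expR s = expR (- s).
    by rewrite expr2 -mulrA [_ * expR s]mulrC expRxMexpNx_1 mulr1.
  rewrite mulr_sumr; apply: ler_sum => k _.
  by rewrite /u gradE real_normK ?num_real// mulrA.
have cv : (fun n => (poisson_sum f x t n - poisson_sum f y t n) ^+ 2) @ \oo -->
    (heat G t f x - heat G t f y) ^+ 2.
  under eq_fun do rewrite expr2.
  by rewrite expr2; apply: cvgM; apply: cvgB.
have ser n : ((\sum_(k < n) u k)%:E <= \sum_(k <oo) (u k)%:E)%E.
  rewrite -sumEFin -(big_mkord xpredT (fun k => (u k)%:E)).
  by apply: nneseries_lim_ge => k _ _; rewrite lee_fin.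
change (((heat G t f x - heat G t f y) ^+ 2)%:E <= \sum_(k <oo) (u k)%:E)%E.
case E : (\sum_(k <oo) (u k)%:E)%E ser => [z| |] ser.
- rewrite lee_fin -(cvg_lim (@Rhausdorff R) cv); apply: limr_le.
    by apply/cvg_ex; exists ((heat G t f x - heat G t f y) ^+ 2).
  by apply: nearW => n; apply: le_trans (bound n) _; rewrite -lee_fin.
- by rewrite leey.
- by have := ser 0%N; rewrite big_ord0 leNgt ltNye.
Qed.

Variable a : R.
Hypothesis atau : a * tau < 1.

Let r := (1 - a * tau)^-1.

(** The integral of [expR (a t)] times the [k]-th Poisson weight at [t / tau] is
    [tau r^(k+1)]. *)
Lemma integral_grad_heat_le f e : finitely_supported f -> edges G e ->
  (\int[lebesgue_measure]_(t in `[0%R, +oo[)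
     (expR (a * t) * (grad (heat G t f) e) ^+ 2)%:E <=
  (tau * r)%:E * \sum_(k <oo) (r ^+ k * grad (iter k P f) e ^+ 2)%:E)%E.
Proof.
move=> fin ee; pose c := tau^-1 - a.
have d0 : 0 < 1 - a * tau by rewrite subr_gt0.
have c0 : 0 < c by rewrite /c subr_gt0 -(mul1r tau^-1) ltr_pdivlMr.
pose d k := grad (iter k P f) e ^+ 2.
have dk0 k : 0 <= d k by exact: sqr_ge0.
pose v k t := (tau ^- k * d k * gamma_weight c k t)%:E.
have tk0 k : 0 <= tau ^- k * d k by rewrite mulr_ge0// invr_ge0 exprn_ge0// ltW.
have mg k D : measurable_fun D (gamma_weight c k).
  by apply: measurable_funTS; apply: continuous_measurable_fun;
    exact: continuous_gamma_weight.
have mD : measurable (`[0%R, +oo[ : set R) by exact: measurable_itv.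
have mv k : measurable_fun (`[0%R, +oo[ : set R) (v k).
  by apply/measurable_EFinP; apply: measurable_funM.
have v0 k t : [set` `[0%R, +oo[] t -> (0 <= v k t)%E.
  rewrite /= in_itv/= andbT => t0; rewrite lee_fin mulr_ge0//.
  exact: gamma_weight_ge0.
apply: (@le_trans _ _ (\int[lebesgue_measure]_(t in `[0%R, +oo[)
    \sum_(k <oo) v k t)%E).
  apply: ge0_le_integral => //.
  - by move=> t _; rewrite lee_fin mulr_ge0 ?expR_ge0 ?sqr_ge0.
  - apply/measurable_EFinP; apply: measurable_funM.
      apply: measurableT_comp => //; exact: measurable_funM.
    have [x [y exy]] := edgesP ee.
    rewrite (_ : (fun t => _) = fun t => (heat G t f x - heat G t f y) ^+ 2).
      by apply: measurable_funX; apply: measurable_funB; exact: measurable_heat.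
    by apply/funext => t; rewrite exy gradE real_normK// num_real.
  - apply: ge0_emeasurable_sum; first by move=> k t Dt _; exact: v0.
    by move=> k _; exact: mv.
  move=> t; rewrite /= in_itv/= andbT => t0.
  have w0 k : 0 <= expR (- (t / tau)) * exp_coeff (t / tau) k
      * grad (iter k P f) e ^+ 2.
    apply: mulr_ge0; last exact: sqr_ge0.
    apply: mulr_ge0; first exact: expR_ge0.
    by apply: exp_coeff_ge0; rewrite divr_ge0// ltW.
  rewrite EFinM; apply: le_trans (lee_wpmul2l _ (grad_heat_sq_le fin ee t0)) _.
    by rewrite lee_fin expR_ge0.
  rewrite -nneseriesZl; last first.
    by move=> k _; rewrite lee_fin w0.
  apply: lee_nneseries => k _.
    by rewrite -EFinM lee_fin mulr_ge0 ?expR_ge0// w0.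
  rewrite -EFinM lee_fin /v /gamma_weight -/(d k).
  have -> : exp_coeff (t / tau) k = tau ^- k * exp_coeff t k.
    by rewrite /exp_coeff/= expr_div_n; ring.
  have ek : 0 <= tau ^- k * exp_coeff t k * d k.
    apply: mulr_ge0 => //; apply: mulr_ge0; last exact: exp_coeff_ge0.
    by rewrite invr_ge0 exprn_ge0// ltW.
  rewrite (_ : tau ^- k * d k * _ =
    expR (- (c * t)) * (tau ^- k * exp_coeff t k * d k)); last by ring.
  rewrite -[X in expR (a * t) * X]mulrA mulrA ler_wpM2r// -expRD ler_expR.
  rewrite /c; lra.
rewrite integral_nneseries// -nneseriesZl; last first.
  move=> k _; rewrite lee_fin; apply: mulr_ge0; last exact: sqr_ge0.
  by apply: exprn_ge0; rewrite invr_ge0 ltW.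
apply: lee_nneseries => k *; first by apply: integral_ge0 => t; exact: v0.
rewrite /v; under eq_integral do rewrite EFinM.
rewrite ge0_integralZl//; last first.
- by rewrite lee_fin tk0.
- by move=> t; rewrite /= in_itv/= andbT => t0; rewrite lee_fin gamma_weight_ge0.
- by apply/measurable_EFinP; exact: mg.
rewrite integral_gamma_weight// -!EFinM lee_fin le_eqVlt; apply/orP; left; apply/eqP.
have cE : c = (1 - a * tau) / tau by rewrite /c; field; rewrite gt_eqF.
rewrite cE -/(d k) /r expr_div_n exprVn !exprS.
have tn : tau != 0 by rewrite gt_eqF.
have dn : 1 - a * tau != 0 by rewrite gt_eqF.
have := expf_neq0 k tn; have := expf_neq0 k dn.
move: (tau ^+ k) ((1 - a * tau) ^+ k) (1 - a * tau) dn => A1 A2 A3 n3 n2 n1.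
by field; rewrite n1 n2 n3 tn.
Qed.

End HeatSquareFunction.

Section FromDiscreteToHeat.
Context {R : realType}.

(** Monotonicity settles the case [l = 0], where the power need not be
    differentiable. *)
Lemma cvg_powR_nondecreasing (u : nat -> R) (l t : R) : 0 < t ->
  (forall n, 0 <= u n) -> nondecreasing_seq u -> u @ \oo --> l ->
  (fun n => u n `^ t) @ \oo --> l `^ t.
Proof.
move=> t0 u0 nd ul.
have ule n : u n <= l.
  rewrite -(cvg_lim (@Rhausdorff R) ul); apply: nondecreasing_cvgn_le => //.
  by apply: cvgP; exact: ul.
have [l0|ln] := eqVneq l 0.
  have -> : (fun n => u n `^ t) = (fun=> l `^ t).
    apply/funext => n; congr (_ `^ _); apply/eqP; rewrite eq_le ule l0.
    exact: u0.
  exact: cvg_cst.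
have lp : 0 < l by rewrite lt_def ln (le_trans (u0 0%N)).
apply: (@continuous_cvg _ _ _ _ _ u (fun x => x `^ t) l _ ul).
apply: differentiable_continuous; apply/derivable1_diffP.
by apply: derivable_powR; rewrite in_itv/= lp.
Qed.

Context {V : choiceType} (G : weighted_graph R V).
Variable M : R.
Hypothesis degM : forall x, deg G x <= M * vertex_weight G x.
Variables (tau p a : R).
Hypotheses (tau0 : 0 < tau) (tauM : tau * M <= 2^-1) (p1 : 1 < p) (p2 : p <= 2)
  (atau : a * tau < 1).

Let P := walk G tau.
Let r := (1 - a * tau)^-1.
Let p0 : 0 < p := lt_trans ltr01 p1.
Let r0 : 0 <= r. Proof. by rewrite invr_ge0 subr_ge0 ltW. Qed.

(** A bound that is uniform in the finite set of edges and in the number of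
    iterates passes to the limit. *)
Lemma lpE_norm_calHa_le (f : V -> R) (K : R) : finitely_supported f ->
  (forall (s : seq (set V)) n, uniq s -> {in s, forall e, edges G e} ->
    \sum_(e <- s) edge_weight G e *
      (\sum_(j < n) r ^+ j * grad (iter j P f) e ^+ 2) `^ (p / 2) <= K) ->
  (lpE_norm G p (calHa G a f) <= (((tau * r) `^ (p / 2) * K) `^ p^-1)%:E)%E.
Proof.
move=> fin HK; rewrite /lpE_norm /lp_norm -poweR_EFin.
have t0 : 0 < p / 2 by rewrite divr_gt0.
have K0 : 0 <= K by have := HK [::] 0%N isT (fun _ => _); rewrite big_nil; apply.
pose S e n := \sum_(j < n) r ^+ j * grad (iter j P f) e ^+ 2.
have term0 e j : 0 <= r ^+ j * grad (iter j P f) e ^+ 2.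
  by apply: mulr_ge0; [exact: exprn_ge0|exact: sqr_ge0].
have S0 e n : 0 <= S e n by exact: sumr_ge0.
have Snd e : nondecreasing_seq (S e).
  by apply/nondecreasing_seqP => n; rewrite /S big_ord_recr/= lerDl.
have Scvg e : edges G e -> cvgn (S e).
  move=> ee; apply: nondecreasing_is_cvgn => //.
  exists ((K / edge_weight G e) `^ (p / 2)^-1) => _ [n _ <-].
  have w0 : 0 < edge_weight G e by exact: edge_weight_gt0.
  have := HK [:: e] n isT _; rewrite big_seq1 -/(S e n) => h.
  have {}h : edge_weight G e * S e n `^ (p / 2) <= K.
    by apply: h => e'; rewrite inE => /eqP->.
  have -> : S e n = (S e n `^ (p / 2)) `^ (p / 2)^-1.
    by rewrite -powRrM divff ?powRr1// gt_eqF.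
  apply: le_powR; rewrite ?invr_ge0 ?(ltW t0) ?powR_ge0//.
  by rewrite ler_pdivlMr// mulrC.
pose sigma e := limn (S e).
have sigma0 e : edges G e -> 0 <= sigma e.
  by move=> ee; apply: limr_ge; [exact: Scvg|apply: nearW => n].
have seriesE e : edges G e ->
    (\sum_(k <oo) (r ^+ k * grad (iter k P f) e ^+ 2)%:E = (sigma e)%:E)%E.
  move=> ee; apply/cvg_lim => //.
  rewrite (_ : (fun n => _) = EFin \o S e).
    by apply: cvg_EFin; [exact: nearW|exact: Scvg].
  by apply/funext => n /=; rewrite /S -sumEFin big_mkord.
have calH_le e : edges G e ->
    (`|calHa G a f e| `^ p <= ((tau * r * sigma e) `^ (p / 2))%:E)%E.
  move=> ee; rewrite /calHa gee0_abs ?poweR_ge0// -poweRrM mulrC -poweR_EFin.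
  apply: gt0_ler_poweR; rewrite ?in_itv/= ?leey ?andbT; first exact: ltW.
  - by apply: integral_ge0 => t _; rewrite lee_fin mulr_ge0 ?expR_ge0 ?sqr_ge0.
  - by rewrite lee_fin !mulr_ge0// ?sigma0// ltW.
  rewrite EFinM -seriesE//.
  exact: (integral_grad_heat_le degM tau0 tauM atau fin ee).
apply: gt0_ler_poweR; rewrite ?in_itv/= ?leey ?andbT ?invr_ge0.
- exact: ltW.
- apply: esum_ge0 => e ee; rewrite mule_ge0 ?poweR_ge0// lee_fin ltW//.
  exact: edge_weight_gt0.
- by rewrite lee_fin mulr_ge0 ?powR_ge0.
apply: ge_ereal_sup => _ [F [finF FE] <-].
rewrite fsbig_finite//=.
have sF : {in (fset_set F : seq (set V)), forall e, edges G e}.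
  by move=> e; rewrite in_fset_set// inE => /FE.
apply: (@le_trans _ _ (\sum_(e <- fset_set F) edge_weight G e *
    (tau * r * sigma e) `^ (p / 2))%:E).
  rewrite -sumEFin big_seq [leRHS]big_seq; apply: lee_sum => e eF.
  rewrite EFinM; apply: lee_wpmul2l; last by apply: calH_le; exact: sF.
  by rewrite lee_fin ltW// edge_weight_gt0//; exact: sF.
rewrite lee_fin.
have -> : \sum_(e <- fset_set F) edge_weight G e * (tau * r * sigma e) `^ (p / 2) =
    (tau * r) `^ (p / 2) * \sum_(e <- fset_set F) edge_weight G e * sigma e `^ (p / 2).
  rewrite mulr_sumr big_seq [RHS]big_seq; apply: eq_bigr => e eF.
  rewrite powRM ?sigma0//; [by rewrite mulrCA| |exact: sF].
  by rewrite mulr_ge0// ltW.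
rewrite ler_wpM2l ?powR_ge0//.
pose T n := \sum_(e <- fset_set F) edge_weight G e * S e n `^ (p / 2).
have Tcvg : T @ \oo --> \sum_(e <- fset_set F) edge_weight G e * sigma e `^ (p / 2).
  rewrite /T [X in _ --> X]big_seq; under eq_fun do rewrite big_seq.
  apply: cvg_big => [|e eF]; first exact: add_continuous.
  by apply: cvgMr; apply: cvg_powR_nondecreasing => //; apply: Scvg; exact: sF.
rewrite -(cvg_lim (@Rhausdorff R) Tcvg); apply: limr_le.
  by apply: cvgP; exact: Tcvg.
by apply: nearW => n; apply: HK sF; exact: fset_uniq.
Qed.

Lemma calHa_bounded (C : R) : 0 <= C ->
  (forall B : {fset V}, dissipation_bound (fun x : B => vertex_weight G (val x))
     (@fset_walk _ _ G tau B) p r C) ->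
  exists C0, 0 < C0 /\ forall f : V -> R, finitely_supported f ->
    (lpE_norm G p (calHa G a f) <= C0%:E * lpV_norm G p f)%E.
Proof.
move=> C0 diss; pose c := (tau * r) `^ (p / 2) * (tau^-1 * square_constant p C).
have sc0 : 0 <= square_constant p C.
  by rewrite /square_constant !mulr_ge0 ?powR_ge0.
have c0 : 0 <= c by rewrite !mulr_ge0 ?powR_ge0// invr_ge0 ltW.
exists (c `^ p^-1 + 1); split; first by rewrite ltr_wpDl ?powR_ge0.
move=> f fin.
have m0 := lpV_mass_ge0 G p f.
have HK s n : uniq s -> {in s, forall e, edges G e} -> _ :=
  fun us es => @discrete_square_function _ _ G M degM tau p tau0 tauM p1 p2
    r C f s n r0 C0 diss fin us es.
apply: le_trans (lpE_norm_calHa_le fin HK) _.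
rewrite (lpV_norm_mass G p0 fin) -EFinM lee_fin mulrA -/c powRM//.
by rewrite ler_wpM2r ?powR_ge0// lerDl.
Qed.

End FromDiscreteToHeat.

(** * Choice of the time step *)

Section UniformBounds.
Context {R : realType} {V : choiceType} (G : weighted_graph R V).

Lemma sup_deg_bound : (sup_deg G < +oo)%E ->
  exists2 M : R, 0 < M & forall x, deg G x <= M * vertex_weight G x.
Proof.
move=> fin; exists (Num.max 1 (fine (sup_deg G))).
  by rewrite lt_max ltr01.
move=> x; rewrite -ler_pdivrMr ?vertex_weight_gt0//.
have : ((deg G x / vertex_weight G x)%:E <= sup_deg G)%E.
  by apply: ereal_sup_ubound; exists x.
case: (sup_deg G) fin => [s _| |]; rewrite ?ltxx ?leeNy_eq //=.
by rewrite /= lee_fin le_max => ->; rewrite orbT.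
Qed.

Variable M : R.
Hypotheses (M0 : 0 < M) (degM : forall x, deg G x <= M * vertex_weight G x).
Variable p : R.
Hypotheses (p1 : 1 < p) (p2 : p <= 2).

(** The rate: with [d] the bound on [l^2] given by the gap, Bernoulli's inequality
    [d `^ (p - 1) <= 1 - (p - 1) (1 - d)] shows that the ratio [d `^ (p - 1)] of
    the decay in [l^p] is below [1 - a tau]. *)
Lemma fset_walk_gap (tau a : R) :
  0 < lambda1 G -> 0 < tau -> tau * M <= 2^-1 -> a * tau < 1 ->
  2 * lambda1 G * tau <= 1 ->
  a < 2 * lambda1 G * (p - 1) * (1 - tau * M) ->
  exists2 C, 0 <= C &
  forall B : {fset V}, dissipation_bound (fun x : B => vertex_weight G (val x))
     (@fset_walk _ _ G tau B) p (1 - a * tau)^-1 C.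
Proof.
move=> lam0 tau0 tauM atau ltau alt.
pose d := 1 - 2 * lambda1 G * tau * (1 - tau * M).
have q0 : 0 <= p - 1 by move: p1; lra.
have tM0 : 0 <= tau * M by rewrite mulr_ge0// ltW.
have d0 : 0 <= d.
  rewrite subr_ge0 (le_trans _ ltau)// ler_piMr ?gerBl//.
  by rewrite !mulr_ge0// ltW.
pose q := d `^ (p - 1); pose r := (1 - a * tau)^-1.
have ra0 : 0 < 1 - a * tau by rewrite subr_gt0.
have r0 : 0 <= r by rewrite invr_ge0 ltW.
have rq : r * q < 1.
  rewrite /r mulrC ltr_pdivrMr// mul1r.
  have := @young_powR R d 1 (p - 1) d0 ler01 _.
  rewrite q0 powR1 mulr1 /= => H; apply: (le_lt_trans (H _)).
    by move: p2; lra.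
  have := alt; rewrite -(ltr_pM2r tau0) /d; lra.
exists (1 - r * q)^-1; first by rewrite invr_ge0 subr_ge0 ltW.
move=> B; have ker := fset_walk_kernel degM tau0 tauM B.
apply: (dissipation_bound_gap ker r0 rq) => g g0; apply: (lp_mass_gap ker p1 p2 d0 _ g0).
move=> h; apply: lazy_walk_gap => //.
- by move=> x; exact: vertex_weight_gt0.
- by move=> x y; exact: mu_ge0.
- by move=> x y; exact: muC.
- by move=> x; exact: sum_mu_le_deg.
- exact: ltW.
- by move=> h'; exact: (spectral_gap_form M0 degM h' lam0).
Qed.

End UniformBounds.

Theorem theorem1p2 (R : realType) (V : choiceType) (G : weighted_graph R V)
    (hM : (sup_deg G < +oo)%E) (p : R) (hp1 : 1 < p) (hp2 : p <= 2) :
  (exists C : R, 0 < C /\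
     forall f : V -> R, finitely_supported f ->
       (lpE_norm G p (calH G f) <= C%:E * lpV_norm G p f)%E) /\
  (0 < lambda1 G ->
     forall a : R, a < 2 * lambda1 G * (p - 1) ->
       exists C : R, 0 < C /\
         forall f : V -> R, finitely_supported f ->
           (lpE_norm G p (calHa G a f) <= C%:E * lpV_norm G p f)%E).
Proof.
have [M M0 degM] := sup_deg_bound hM.
split.
  pose tau := (2 * M)^-1.
  have tau0 : 0 < tau by rewrite invr_gt0 mulr_gt0.
  have tauM : tau * M <= 2^-1 by rewrite /tau invfM mulfVK// gt_eqF.
  have H0 : calH G = calHa G 0.
    apply/funext => f; apply/funext => e; rewrite /calH /calHa.
    by under [in RHS]eq_integral do rewrite mul0r expR0 mul1r.
  rewrite H0; apply: (calHa_bounded degM tau0 tauM hp1 hp2 _ ler01).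
    by rewrite mul0r.
  move=> B; rewrite mul0r subr0 invr1.
  exact: (dissipation_bound1 (fset_walk_kernel degM tau0 tauM B)).
move=> lam0 a alt.
pose D := 2 * lambda1 G * (p - 1).
have D0 : 0 < D by rewrite !mulr_gt0// subr_gt0.
have Da : 0 < D - a by rewrite subr_gt0.
have a1 : 0 < `|a| + 1 by rewrite ltr_wpDl.
(* all the constraints on the step hold for small [tau], the last one because
   [a < D] *)
have [tau [tau0 tauM atau ltau alt']] : exists tau, [/\ 0 < tau, tau * M <= 2^-1,
    a * tau < 1, 2 * lambda1 G * tau <= 1 & a < D * (1 - tau * M)].
  pose t1 := (2 * M)^-1; pose t2 := (2 * (`|a| + 1))^-1.
  pose t3 := (2 * lambda1 G)^-1; pose t4 := (D - a) / (2 * D * M).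
  pose tau := Num.min (Num.min t1 t2) (Num.min t3 t4).
  have tau0 : 0 < tau.
    have h1 : 0 < t1 by rewrite invr_gt0 mulr_gt0.
    have h2 : 0 < t2 by rewrite invr_gt0 mulr_gt0.
    have h3 : 0 < t3 by rewrite invr_gt0 mulr_gt0.
    have h4 : 0 < t4 by rewrite divr_gt0// mulr_gt0// mulr_gt0.
    by rewrite !lt_min h1 h2 h3.
  have [h1 h2 h3 h4] : [/\ tau <= t1, tau <= t2, tau <= t3 & tau <= t4].
    by split; rewrite !ge_min lexx ?orbT.
  exists tau; split => //.
  - apply: (@le_trans _ _ (t1 * M)); first by rewrite ler_pM2r.
    by rewrite /t1 invfM mulfVK// gt_eqF.
  - apply: (@le_lt_trans _ _ ((`|a| + 1) * t2)).
      apply: (@le_trans _ _ ((`|a| + 1) * tau)); last by rewrite ler_pM2l.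
      by rewrite ler_pM2r//; have := ler_norm a; lra.
    by rewrite /t2 invfM mulrCA divff ?gt_eqF// mulr1; lra.
  - apply: (@le_trans _ _ (2 * lambda1 G * t3)).
      by rewrite ler_pM2l// mulr_gt0.
    by rewrite divff// gt_eqF// mulr_gt0.
  - have : D * (tau * M) <= (D - a) / 2.
      apply: (@le_trans _ _ (D * (t4 * M))).
        by rewrite ler_pM2l// ler_pM2r.
      rewrite le_eqVlt; apply/orP; left; apply/eqP; rewrite /t4; field.
      by rewrite !gt_eqF.
    by rewrite mulrBr mulr1; lra.
have [C C0 diss] := fset_walk_gap M0 degM hp1 hp2 lam0 tau0 tauM atau ltau alt'.
exact: (calHa_bounded degM tau0 tauM hp1 hp2 atau C0 diss).
Qed.
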